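(* Fix a dimension $d$ and a closed bounded convex polyhedron $C\subset\mathbb{R}^d$ containing the origin in its interior. There is an algorithm that, given $0<\varepsilon<1$ and a finite set $S\subset\mathbb{R}^d$ of $n$ points satisfying the sampling assumption (see context), outputs in $O(\varepsilon^{-d}n)$ time a $(1+\varepsilon)$-approximation of the minimum width annulus of $S$ under translations, i.e. a center $g\in\mathbb{R}^d$ (together with the annulus $\mathrm{MWA}(g)$) such that $|\mathrm{MWA}(g)|\le(1+\varepsilon)\,w_{opt}$. The constant hidden in the $O$-notation depends only on $d$ and $C$.
   Context: For $p,q\in\mathbb{R}^d$ the convex distance function induced by $C$ is $d_C(p,q)=\min\{r\ge 0: q\in p+rC\}$ (it need not be symmetric). For a finite set $S\subset\mathbb{R}^d$ and a point $p\in\mathbb{R}^d$, let $|\mathrm{MinBall}(p)|=\max_{s\in S}d_C(p,s)$ and $|\mathrm{MaxBall}(p)|=\min_{s\in S}d_C(p,s)$. $\mathrm{MWA}(p)$ denotes the annulus for $C$ centered at $p$ with inner radius $|\mathrm{MaxBall}(p)|$ and outer radius $|\mathrm{MinBall}(p)|$ (the region between the concentric placements $p+|\mathrm{MaxBall}(p)|C$ and $p+|\mathrm{MinBall}(p)|C$, boundaries included); its width is $|\mathrm{MWA}(p)|=|\mathrm{MinBall}(p)|-|\mathrm{MaxBall}(p)|$. The minimum width annulus $\mathrm{MWA}$ of $S$ (under translations) is $\mathrm{MWA}(c_{opt})$, where $c_{opt}$ minimizes $|\mathrm{MWA}(p)|$ over all $p$ in the convex hull of $S$; put $R_{opt}=|\mathrm{MinBall}(c_{opt})|$,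 $r_{opt}=|\mathrm{MaxBall}(c_{opt})|$, $w_{opt}=|\mathrm{MWA}|=R_{opt}-r_{opt}$. Sampling assumption: $S$ is a $\delta$-uniform sample of a surface $\Sigma\subset\mathbb{R}^d$ (every point of $\Sigma$ is within distance $\delta$ of a point of $S$) with $\delta$ small enough that $S$ contains at least one point between each pair of corresponding facets of the MWA; that is, for every facet $\varphi$ of $C$ there are $s\in S$, $y\in\varphi$ and $\lambda\in[r_{opt},R_{opt}]$ with $s=c_{opt}+\lambda y$. The number of facets of $C$ is regarded as a constant. Running time is counted in a unit-cost model of real arithmetic. *)

(* Defs.v *)
From HB Require Import structures.
From mathcomp Require Import all_boot all_order all_algebra.
From mathcomp Require Import all_classical all_reals all_analysis.

Set Implicit Arguments.
Unset Strict Implicit.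
Unset Printing Implicit Defensive.

Import Order.TTheory GRing.Theory Num.Theory.
Import numFieldNormedType.Exports.

Local Open Scope classical_set_scope.
Local Open Scope ring_scope.

Section Geometry.
Variables (R : realType) (d : nat).
Implicit Types (x y p q c : 'rV[R]_d) (C F Sigma : set 'rV[R]_d).
Implicit Types (S : seq 'rV[R]_d).

Definition dot x y : R := \sum_(k < d) x ord0 k * y ord0 k.

Definition euclid_norm x : R := Num.sqrt (dot x x).

Definition polyhedron C : Prop :=
  exists (m : nat) (a : 'I_m -> 'rV[R]_d) (b : 'I_m -> R),
    C = [set x | forall i, dot (a i) x <= b i].

Definition affinely_independent (k : nat) (v : 'I_k.+1 -> 'rV[R]_d) : bool :=
  row_free (\matrix_(i < k) (v (lift ord0 i) - v ord0)).

Definition contains_affinely_independent F (k : nat) : Prop :=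
  exists2 v : 'I_k.+1 -> 'rV[R]_d, affinely_independent v & forall i, F (v i).

Definition affine_dim F (k : nat) : Prop :=
  contains_affinely_independent F k /\ ~ contains_affinely_independent F k.+1.

(* A facet is the intersection with a supporting hyperplane (a face) of
   dimension d - 1. *)
Definition facet C F : Prop :=
  (exists (a : 'rV[R]_d) (b : R),
    [/\ a != 0, forall x, C x -> dot a x <= b
      & F = C `&` [set x | dot a x = b]])
  /\ (exists2 k : nat, k.+1 = d & affine_dim F k).

Definition convex_hull S : set 'rV[R]_d :=
  [set p | exists w : 'I_(size S) -> R,
     [/\ forall i, 0 <= w i, \sum_i w i = 1
       & p = \sum_i w i *: nth 0 S i]].

(* When C is closed, bounded and a neighbourhood of 0, this infimum is
   attained, i.e. it is min {r >= 0 : q \in p + r C}. *)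
Definition convex_dist C p q : R :=
  inf [set r : R | 0 <= r /\ exists2 y, C y & q = p + r *: y].

(* For nonempty S the sup and inf below range over a finite nonempty set, so
   they are the maximum and the minimum. *)
Definition minball_radius C S p : R :=
  sup [set convex_dist C p s | s in [set` S]].

Definition maxball_radius C S p : R :=
  inf [set convex_dist C p s | s in [set` S]].

Record annulus := Annulus {
  center : 'rV[R]_d;
  inner_radius : R;
  outer_radius : R }.

Definition width (A : annulus) : R := outer_radius A - inner_radius A.

Definition MWA C S p : annulus :=
  Annulus p (maxball_radius C S p) (minball_radius C S p).

Definition optimal_center C S c : Prop :=
  convex_hull S c /\
  forall p, convex_hull S p -> width (MWA C S c) <= width (MWA C S p).

Definition uniform_sample Sigma (delta : R) S : Prop :=
  forall x, Sigma x -> exists2 s, s \in S & euclid_norm (x - s) <= delta.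

(* The region of A between the two copies of F, one on the inner and one on
   the outer boundary. *)
Definition between_facets (A : annulus) F : set 'rV[R]_d :=
  [set x | exists (y : 'rV[R]_d) (lam : R),
     [/\ F y, inner_radius A <= lam <= outer_radius A
       & x = center A + lam *: y]].

Definition samples_facets C S (A : annulus) : Prop :=
  forall F, facet C F -> exists2 s, s \in S & between_facets A F s.

End Geometry.

(* Unit-cost real RAM: integer and real registers (a program mentions only
   finitely many of them, by fixed indices), an indirectly addressed memory of
   reals, the four field operations on reals, addition and truncated
   subtraction on indices, and comparisons.  There is no rounding and no
   conversion between reals and integers.  Programs are structured; every
   instruction and every evaluation of a test costs 1. *)
Section RealRAM.
Variable R : realType.

Record state := State {
  ireg : nat -> nat;
  rreg : nat -> R;
  mem : nat -> R }.

Definition upd (T : Type) (f : nat -> T) (i : nat) (v : T) : nat -> T :=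
  fun j => if j == i then v else f j.

(* The first argument of an instruction is the destination register, except
   for RStore a i, which writes real register i to the memory cell whose
   address is in integer register a. *)
Inductive instr :=
| IConst (i k : nat)
| IAdd (i j k : nat)
| ISub (i j k : nat)
| RConst (i : nat) (x : R)
| RAdd (i j k : nat)
| RSub (i j k : nat)
| RMul (i j k : nat)
| RDiv (i j k : nat)
| RLoad (i a : nat)
| RStore (a i : nat).

Inductive test :=
| ILt (i j : nat)
| RLt (i j : nat)
| RLe (i j : nat).

Inductive program :=
| Skip
| Instr (c : instr)
| Seq (P Q : program)
| If (b : test) (P Q : program)
| While (b : test) (P : program).

Definition legal (c : instr) (s : state) : bool :=
  if c is RDiv _ _ k then rreg s k != 0 else true.

Definition step (c : instr) (s : state) : state :=
  let: State ix X M := s in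
  match c with
  | IConst i k => State (upd ix i k) X M
  | IAdd i j k => State (upd ix i (ix j + ix k)%N) X M
  | ISub i j k => State (upd ix i (ix j - ix k)%N) X M
  | RConst i x => State ix (upd X i x) M
  | RAdd i j k => State ix (upd X i (X j + X k)) M
  | RSub i j k => State ix (upd X i (X j - X k)) M
  | RMul i j k => State ix (upd X i (X j * X k)) M
  | RDiv i j k => State ix (upd X i (X j / X k)) M
  | RLoad i a => State ix (upd X i (M (ix a))) M
  | RStore a i => State ix X (upd M (ix a) (X i))
  end.

Definition holds (b : test) (s : state) : bool :=
  match b with
  | ILt i j => (ireg s i < ireg s j)%N
  | RLt i j => rreg s i < rreg s j
  | RLe i j => rreg s i <= rreg s j
  end.

(* exec P s t s': started in s, the program P halts in s' after t steps. *)
Inductive exec : program -> state -> nat -> state -> Prop :=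
| exec_skip s : exec Skip s 0 s
| exec_instr c s : legal c s -> exec (Instr c) s 1 (step c s)
| exec_seq P Q s1 s2 s3 t1 t2 :
    exec P s1 t1 s2 -> exec Q s2 t2 s3 -> exec (Seq P Q) s1 (t1 + t2) s3
| exec_if_true b P Q s s' t :
    holds b s -> exec P s t s' -> exec (If b P Q) s t.+1 s'
| exec_if_false b P Q s s' t :
    ~~ holds b s -> exec Q s t s' -> exec (If b P Q) s t.+1 s'
| exec_while_false b P s :
    ~~ holds b s -> exec (While b P) s 1 s
| exec_while_true b P s1 s2 s3 t1 t2 :
    holds b s1 -> exec P s1 t1 s2 -> exec (While b P) s2 t2 s3 ->
    exec (While b P) s1 (t1 + t2).+1 s3.

(* exec is deterministic, so in a statement "exists t s', exec P s t s' /\ ..."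
   the pair t, s' is the running time and the result of P. *)
Lemma exec_det P s t1 s1 t2 s2 :
  exec P s t1 s1 -> exec P s t2 s2 -> t1 = t2 /\ s1 = s2.
Proof.
move=> E; elim: E t2 s2 => {P s t1 s1}; intros;
  match goal with E : exec _ _ _ _ |- _ => inversion E; subst; clear E end;
  repeat match goal with
  | IH : forall t s, exec ?P ?s1 t s -> _, H : exec ?P ?s1 _ _ |- _ =>
      case: (IH _ _ H) => ? ?; subst; clear H
  end;
  by [split | match goal with
              | h : is_true (holds _ _), h' : is_true (~~ _) |- _ =>
                  rewrite h in h'
              end].
Qed.

Variable d : nat.

(* The input: n in integer register 0, eps in real register 0, and coordinate
   k of point number j in memory cell j * d + k; everything else is 0. *)
Definition input (eps : R) (S : seq 'rV[R]_d) : state :=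
  State (upd (fun=> 0%N) 0 (size S))
        (upd (fun=> 0) 0 eps)
        (nth 0 (flatten [seq [seq s ord0 k | k <- enum 'I_d]
                        | s : 'rV[R]_d <- S])).

Definition output (s : state) : annulus R d :=
  Annulus (\row_(k < d) rreg s k) (rreg s d) (rreg s d.+1).

End RealRAM.

(* Main.v *)
Require Import Defs.
From HB Require Import structures.
From mathcomp Require Import all_boot all_order all_algebra.
From mathcomp Require Import all_classical all_reals all_analysis.
From mathcomp Require Import zify ring lra.

Set Implicit Arguments.
Unset Strict Implicit.
Unset Printing Implicit Defensive.

Import Order.TTheory GRing.Theory Num.Theory.
Import numFieldNormedType.Exports.

Local Open Scope classical_set_scope.
Local Open Scope ring_scope.

(* Write C = {x | a_i.x <= 1 for all i} irredundantly, so that every a_i defines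
   a facet and d_C(p, q) = max(0, max_i a_i.(q - p)).  Put h_i = max_(s in S) a_i.s.
   Every h_i - a_i.c_opt is at most R_opt, and at least r_opt because S has a point
   between the two copies of facet i.  As C is bounded, the matrix with rows
   (a_i, 1) has a left inverse, so c_opt is, up to an error O(w_opt), a fixed linear
   function p of the h_i: no linear program has to be solved.  The width is
   Lipschitz in the center, so |MWA(p)| = O(w_opt), and it suffices to try, besides
   p, the O(eps^-d) points of a grid of radius O(|MWA(p)|) and spacing
   O(eps |MWA(p)|) around p, each in time O(n). *)

(** * Polytopes and their facets *)

(** The sampling assumption speaks of facets only, so every inequality that is kept must define one;
    this is why irredundancy matters. As [w_opt] is unknown to the program, the grid is scaled by
    |MWA(p)|: large enough to reach c_opt as soon as p is worse than c_opt, and not too large by the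
    Lipschitz bound. In units of its radius the grid fills [-1, 1]^d with a step depending on eps
    and C alone, so its size is independent of S. No program here divides, so a zero radius does no
    harm. The machine can neither round nor convert integers to reals; hence the grid coordinates
    are themselves real loop counters. Since d and C are fixed, loops over coordinates and facets
    are unrolled, and only the pass over the points and the d nested grid loops are [While]
    loops. *)

Section Dot.
Variables (R : realType) (d : nat).
Implicit Types a v x y : 'rV[R]_d.

Lemma dotDr a x y : dot a (x + y) = dot a x + dot a y.
Proof. by rewrite /dot -big_split; apply: eq_bigr => k _; rewrite mxE mulrDr. Qed.

Lemma dotZr a c x : dot a (c *: x) = c * dot a x.
Proof. by rewrite /dot mulr_sumr; apply: eq_bigr => k _; rewrite mxE mulrCA. Qed.

Lemma dotZl a c x : dot (c *: a) x = c * dot a x.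
Proof. by rewrite /dot mulr_sumr; apply: eq_bigr => k _; rewrite mxE mulrA. Qed.

Lemma dotNr a x : dot a (- x) = - dot a x.
Proof. by rewrite -scaleN1r dotZr mulN1r. Qed.

Lemma dotBr a x y : dot a (x - y) = dot a x - dot a y.
Proof. by rewrite dotDr dotNr. Qed.

Lemma dotr0 a : dot a 0 = 0.
Proof. by rewrite -(scale0r 0) dotZr mul0r. Qed.

Lemma dot0l x : dot 0 x = 0.
Proof. by rewrite -(scale0r 0) dotZl mul0r. Qed.

Lemma dotE a x : dot a x = (x *m a^T) 0 0.
Proof. by rewrite mxE; apply: eq_bigr => k _; rewrite mxE mulrC. Qed.

Lemma mx_dot0P n (B : 'M[R]_(n, d)) a :
  B *m a^T = 0 <-> forall i, dot a (row i B) = 0.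
Proof.
split=> [B0 i|B0]; first by rewrite dotE -row_mul B0 !mxE.
by apply/row_matrixP => i; apply/rowP => j; rewrite row_mul ord1 -dotE B0 !mxE.
Qed.

Lemma norm_dot_le a v (e : R) : (forall k, `|v ord0 k| <= e) ->
  `|dot a v| <= (\sum_k `|a ord0 k|) * e.
Proof.
move=> ve; rewrite mulr_suml; apply: le_trans (ler_norm_sum _ _ _) _.
by apply: ler_sum => k _; rewrite normrM ler_wpM2l.
Qed.

End Dot.

Section Polytope.
Variables (R : realType) (d : nat).
Implicit Types (x y v : 'rV[R]_d) (C : set 'rV[R]_d).

Definition halfspaces (m : nat) (a : 'I_m -> 'rV[R]_d) (b : 'I_m -> R) :=
  [set x | forall i, dot (a i) x <= b i].

Lemma interior_ball C : interior C 0 ->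
  exists2 e : R, 0 < e & forall x, `|x| < e -> C x.
Proof.
rewrite /interior => /= /nbhs_normP [e e0 eC]; exists e => // x xe.
by apply: eC; rewrite /ball_/= sub0r normrN.
Qed.

Lemma bounded_no_ray C v : bounded_set C ->
  (forall s : R, 0 <= s -> C (s *: v)) -> v = 0.
Proof.
move=> [M [_ MC]] vC; apply: contrapT => /eqP v0.
have {}MC x : C x -> `|x| <= `|M| + 1.
  by apply: MC; rewrite (le_lt_trans (ler_norm M))// ltrDl.
have v1 : 0 < `|v| by rewrite normr_gt0.
have M2 : 0 <= (`|M| + 2) / `|v| by rewrite divr_ge0// addr_ge0.
have := MC _ (vC _ M2); rewrite normrZ ger0_norm// divfK ?gt_eqF//.
by rewrite lerD2l; lra.
Qed.

(** Provides the directions inside the hyperplane of an inequality along which a face is shown to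
    have dimension [d - 1]. *)
Lemma orthogonal_basis n (a : 'rV[R]_n.+1) : a != 0 ->
  exists2 B : 'M[R]_(n, n.+1), row_free B & B *m a^T = 0.
Proof.
move=> a0; have E : \rank (kermx a^T) = n.
  by rewrite mxrank_ker mxrank_tr rank_rV a0 subn1.
have : exists2 B : 'M[R]_(\rank (kermx a^T), n.+1), row_free B & B *m a^T = 0.
  exists (row_base (kermx a^T)); first exact: row_base_free.
  by apply/sub_kermxP; rewrite eq_row_base.
by move: (\rank _) E => r E; subst r.
Qed.

End Polytope.

(* An inequality that cannot be dropped is the only tight one at some boundary
   point, and near that point its hyperplane stays inside C. *)
Lemma irredundant_facet (R : realType) (d : nat) (C : set 'rV[R]_d)
    (m : nat) (a : 'I_m -> 'rV[R]_d) (b : 'I_m -> R) (i : 'I_m) (x : 'rV[R]_d) :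
  C = halfspaces a b -> (forall j, 0 < b j) ->
  (forall j, j != i -> dot (a j) x <= b j) -> b i < dot (a i) x ->
  facet C (C `&` [set x | dot (a i) x = b i]).
Proof.
move=> CE b_gt0 xC xi.
have ai_neq0 : a i != 0.
  by apply: contraTneq xi => ->; rewrite dot0l -leNgt ltW.
split.
  exists (a i), (b i); split=> // y; rewrite CE => yC; exact: yC.
have xi0 : 0 < dot (a i) x by apply: lt_trans xi.
(* The segment from the origin, where all inequalities are strict, crosses the hyperplane of [a i]
   before reaching [x]; at the crossing the other inequalities are still strict. *)
pose y := (b i / dot (a i) x) *: x.
have yi : dot (a i) y = b i by rewrite dotZr divfK// gt_eqF.
have yj j : j != i -> dot (a j) y < b j.
  move=> ji; rewrite dotZr; have [xj|xj] := leP (dot (a j) x) 0.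
    by apply: le_lt_trans (b_gt0 j); rewrite mulr_ge0_le0// divr_ge0// ltW.
  apply: lt_le_trans (xC j ji).
  by rewrite gtr_pMl// ltr_pdivrMr// mul1r.
clearbody y.
have [n dE] : exists n, d = n.+1.
  have /rV0Pn [k _] := ai_neq0; exists d.-1.
  by rewrite prednK// (leq_ltn_trans _ (ltn_ord k)).
subst d; exists n => //; split.
  have [B Bfree B0] := orthogonal_basis ai_neq0.
  have Bi k := (mx_dot0P B (a i)).1 B0 k.
  (* [D j] bounds the growth of [a j] along any basis vector, the 1 making it a divisor; the step
     [g] is then too short to use up the slack of any other inequality. *)
  pose D (j : 'I_m) := 1 + \sum_k `|dot (a j) (row k B)|.
  have D1 j : 1 <= D j by rewrite lerDl sumr_ge0.
  have D0 j : 0 < D j by apply: lt_le_trans (D1 j).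
  pose g := \big[Order.min/1]_(j | j != i) ((b j - dot (a j) y) / D j).
  have g_gt0 : 0 < g.
    apply: (big_ind (fun z => 0 < z)) => [//|u v u0 v0|j ji].
      by rewrite lt_min u0.
    by rewrite divr_gt0// subr_gt0 yj.
  have gC k : C (y + g *: row k B).
    rewrite CE => j; rewrite dotDr dotZr.
    have [->|ji] := eqVneq j i; first by rewrite Bi mulr0 addr0 yi.
    rewrite -lerBrDl; apply: le_trans (_ : g * D j <= _); last first.
      by rewrite -ler_pdivlMr// /g; apply: bigmin_le_cond.
    rewrite ler_pM2l//; apply: le_trans (ler_norm _) _.
    by rewrite /D (bigD1 k)//= addrCA lerDl addr_ge0// sumr_ge0.
  exists (fun k => if unlift ord0 k is Some k' then y + g *: row k' B else y).
    rewrite /affinely_independent (_ : \matrix_(_ < n) _ = g *: B).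
      by rewrite /row_free mxrank_scale_nz// gt_eqF.
    apply/row_matrixP => k; rewrite rowK liftK unlift_none addrAC subrr add0r.
    by apply/rowP => l; rewrite !mxE.
  move=> k; case: unliftP => [k' _|_]; split;
    rewrite /= ?dotDr ?dotZr ?Bi ?mulr0 ?addr0//.
  by rewrite CE => j; have [->|/yj/ltW//] := eqVneq j i; rewrite yi.
(* The differences of [d + 1] affinely independent points of the face would form an invertible
   matrix that annihilates [a i]. *)
move=> [v vfree vF]; move/negP: ai_neq0; apply.
move: vfree; rewrite /affinely_independent row_free_unit.
set V := \matrix_(_ < _) _ => Vunit.
have : V *m (a i)^T = 0.
  apply/mx_dot0P => k; rewrite rowK dotBr.
  by have [[_ /= ->] [_ /= ->]] := (vF (lift ord0 k), vF ord0); rewrite subrr.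
move/(congr1 (mulmx (invmx V))); rewrite mulKmx// mulmx0.
by move/(congr1 trmx); rewrite trmxK trmx0 => ->.
Qed.

(** A description by the fewest inequalities is irredundant, and the interior origin makes all
    right-hand sides positive, so that they can be scaled to 1. *)
Lemma polyhedron_facets (R : realType) (d : nat) (C : set 'rV[R]_d) :
  polyhedron C -> interior C 0 ->
  exists (m : nat) (a : 'I_m -> 'rV[R]_d), C = halfspaces a (fun=> 1) /\
    forall i, facet C (C `&` [set x | dot (a i) x = 1]).
Proof.
move=> Cpoly /interior_ball [e e0 eC].
pose Q m := `[< exists (a : 'I_m -> 'rV[R]_d) (b : 'I_m -> R), C = halfspaces a b >].
have exQ : exists m, Q m.
  by case: Cpoly => m [a [b CE]]; exists m; apply/asboolP; exists a, b.
case: (ex_minnP exQ) => m /asboolP [a [b CE]] minm.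
have C0 : C 0 by apply: eC; rewrite normr0.
have irr i : exists2 x, forall j, j != i -> dot (a j) x <= b j & b i < dot (a i) x.
  apply: contrapT => noX.
  case: m i a b CE minm noX => [[]//|m] i a b CE minm noX.
  have : Q m.
    apply/asboolP; exists (a \o lift i), (b \o lift i); apply/seteqP; split=> x.
      by rewrite CE => xC j; apply: xC.
    move=> xC; rewrite CE.
    have xC' j : j != i -> dot (a j) x <= b j.
      by case: (unliftP i j) => [j' ->|->]; rewrite ?eqxx// => _; apply: xC.
    move=> j; have [->|/xC'//] := eqVneq j i.
    by rewrite leNgt; apply/negP => xi; apply: noX; exists x.
  by move/minm; rewrite ltnn.
(* A small positive multiple of [x] still lies in [C], and [a i] is positive there. *)
have b_gt0 i : 0 < b i.
  have [x xC xi] := irr i.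
  have b0 : 0 <= b i by rewrite -(dotr0 (a i)); move: C0; rewrite CE; apply.
  have x0 : 0 < dot (a i) x by apply: le_lt_trans xi.
  have c0 : 0 < `|x| + 1 by apply: ltr_wpDl.
  have : C ((e / (`|x| + 1)) *: x).
    apply: eC; rewrite normrZ ger0_norm ?divr_ge0 ?(ltW e0) ?(ltW c0)//.
    by rewrite mulrAC ltr_pdivrMr// ltr_pM2l// ltrDl.
  rewrite CE => /(_ i); apply: lt_le_trans.
  by rewrite dotZr mulr_gt0// divr_gt0.
have scale_eq i x : dot ((b i)^-1 *: a i) x = dot (a i) x / b i.
  by rewrite dotZl mulrC.
exists m, (fun i => (b i)^-1 *: a i); split.
  by rewrite CE; apply/seteqP; split=> x xC i; move: (xC i);
    rewrite scale_eq ler_pdivrMr// mul1r.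
move=> i; have [x xC xi] := irr i.
rewrite (_ : [set x | _] = [set x | dot (a i) x = b i]).
  exact: irredundant_facet CE b_gt0 xC xi.
apply/seteqP; split=> y /=; rewrite scale_eq => yi.
  by rewrite -[LHS](@divfK _ (b i)) ?gt_eqF// yi mul1r.
by rewrite yi divff// gt_eqF.
Qed.

(** * Widths of annuli *)

Section Extrema.
Variable R : realType.
Implicit Types (E : set R) (x : R).

Lemma inf_min E x : E x -> lbound E x -> inf E = x.
Proof.
move=> Ex lbx; apply/eqP; rewrite eq_le; apply/andP; split.
  by apply: ge_inf => //; exists x.
by apply: lb_le_inf => //; exists x.
Qed.

Lemma sup_max E x : E x -> ubound E x -> sup E = x.
Proof.
move=> Ex ubx; apply/eqP; rewrite eq_le; apply/andP; split.
  by apply: ge_sup => //; exists x.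
by apply: ub_le_sup => //; exists x.
Qed.

Definition is_max (T : eqType) (f : T -> R) (S : seq T) x :=
  (exists2 s, s \in S & f s = x) /\ {in S, forall s, f s <= x}.

Definition is_min (T : eqType) (f : T -> R) (S : seq T) x :=
  (exists2 s, s \in S & f s = x) /\ {in S, forall s, x <= f s}.

Lemma ex_is_max (T : eqType) (f : T -> R) (S : seq T) :
  S != [::] -> exists x, is_max f S x.
Proof.
elim: S => [//|s S IH _]; have [->|/IH [x [[t tS tx] Sx]]] := eqVneq S [::].
  by exists (f s); split=> [|t];
    [exists s; rewrite ?mem_head|rewrite inE => /eqP ->].
have [fx|xf] := leP (f s) x.
  exists x; split=> [|r]; first by exists t; rewrite // inE tS orbT.
  by rewrite inE => /predU1P [->//|/Sx].
exists (f s); split=> [|r]; first by exists s; rewrite ?mem_head.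
by rewrite inE => /predU1P [->//|/Sx /le_trans]; apply; apply: ltW.
Qed.

Lemma ex_is_min (T : eqType) (f : T -> R) (S : seq T) :
  S != [::] -> exists x, is_min f S x.
Proof.
move=> /(ex_is_max (fun s => - f s)) [x [[t tS tx] Sx]]; exists (- x).
by split=> [|s /Sx]; [exists t; rewrite // -tx opprK|rewrite lerNl].
Qed.

Lemma is_max_inj (T : eqType) (f : T -> R) (S : seq T) x y :
  is_max f S x -> is_max f S y -> x = y.
Proof.
move=> [[s sS sx] Sx] [[t tS ty] Sy]; apply/eqP.
by rewrite eq_le -{1}sx -{2}ty Sy// Sx.
Qed.

End Extrema.

Section Gauge.
Variables (R : realType) (d m : nat) (C : set 'rV[R]_d) (a : 'I_m -> 'rV[R]_d).
Hypothesis CE : C = halfspaces a (fun=> 1).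
Hypothesis C_bounded : bounded_set C.
Implicit Types (p q v c g : 'rV[R]_d) (S : seq 'rV[R]_d).

Definition gauge v : R := \big[Num.max/0]_i dot (a i) v.

Lemma gauge_ge0 v : 0 <= gauge v.
Proof. exact: bigmax_ge_id. Qed.

Lemma gauge_ge i v : dot (a i) v <= gauge v.
Proof. exact: le_bigmax. Qed.

Lemma gauge_le v (r : R) : 0 <= r -> (forall i, dot (a i) v <= r) -> gauge v <= r.
Proof. by move=> r0 vr; apply: bigmax_le. Qed.

Lemma gaugeD u v : gauge (u + v) <= gauge u + gauge v.
Proof.
apply: gauge_le => [|i]; first by rewrite addr_ge0 ?gauge_ge0.
by rewrite dotDr lerD ?gauge_ge.
Qed.

(** Such a [v] is a recession direction of [C], and a bounded set contains no ray. *)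
Lemma gauge_nonpos v : (forall i, dot (a i) v <= 0) -> v = 0.
Proof.
move=> v0; apply: (bounded_no_ray C_bounded) => s s0; rewrite CE => i.
by rewrite dotZr (le_trans _ ler01)// mulr_ge0_le0.
Qed.

Lemma convex_distE p q : convex_dist C p q = gauge (q - p).
Proof.
apply: inf_min => /=.
  split; first exact: gauge_ge0.
  (* A zero gauge cannot be divided by, but it forces [q = p], and the origin serves as [y]. *)
  have [g0|g0] := eqVneq (gauge (q - p)) 0.
    exists 0; first by rewrite CE => i; rewrite dotr0.
    apply/eqP; rewrite scaler0 addr0 -subr_eq0; apply/eqP/gauge_nonpos => i.
    by rewrite -g0 gauge_ge.
  exists ((gauge (q - p))^-1 *: (q - p)); last by rewrite scalerKV// addrC subrK.
  rewrite CE => i; rewrite dotZr mulrC ler_pdivrMr ?mul1r ?gauge_ge//.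
  by rewrite lt_def g0 gauge_ge0.
move=> r [r0 [y yC ->]]; apply: gauge_le => // i.
rewrite addrAC subrr add0r dotZr ler_piMr//.
by move: yC; rewrite CE.
Qed.

Lemma minballE S p x : is_max (fun s => gauge (s - p)) S x ->
  minball_radius C S p = x.
Proof.
move=> [[s sS sx] Sx]; apply: sup_max.
  by exists s => //; rewrite convex_distE.
by move=> _ [t /= /Sx tx <-]; rewrite convex_distE.
Qed.

Lemma maxballE S p x : is_min (fun s => gauge (s - p)) S x ->
  maxball_radius C S p = x.
Proof.
move=> [[s sS sx] Sx]; apply: inf_min.
  by exists s => //; rewrite convex_distE.
by move=> _ [t /= /Sx tx <-]; rewrite convex_distE.
Qed.

(** A Lipschitz constant of the gauge for the sup norm, kept at least 1 by the first summand. *)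
Definition gauge_bound : R := 1 + \sum_i \sum_k `|a i ord0 k|.

Lemma gauge_bound_ge1 : 1 <= gauge_bound.
Proof. by rewrite lerDl sumr_ge0// => i _; rewrite sumr_ge0. Qed.

Lemma gauge_le_norm v (e : R) : 0 <= e -> (forall k, `|v ord0 k| <= e) ->
  gauge v <= gauge_bound * e.
Proof.
move=> e0 ve; apply: gauge_le => [|i].
  by rewrite mulr_ge0// (le_trans ler01) ?gauge_bound_ge1.
apply: le_trans (ler_norm _) _; apply: le_trans (norm_dot_le _ ve) _.
apply: ler_wpM2r => //; rewrite /gauge_bound (bigD1 i)//= addrCA lerDl addr_ge0//.
by rewrite sumr_ge0// => j _; rewrite sumr_ge0.
Qed.

(** By the triangle inequality each of the two radii changes by at most [gauge_bound * e]. The gauge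
    is not symmetric, but the sup norm controls it in both directions. *)
Lemma width_lipschitz S c g (e : R) : S != [::] -> 0 <= e ->
  (forall k, `|g ord0 k - c ord0 k| <= e) ->
  width (MWA C S g) <= width (MWA C S c) + 2 * gauge_bound * e.
Proof.
move=> S0 e0 gce.
have near p q : (forall k, `|q ord0 k - p ord0 k| <= e) ->
    forall s, gauge (s - p) <= gauge (s - q) + gauge_bound * e.
  move=> pq s; rewrite -(subrKA q) addrC (le_trans (gaugeD _ _))//.
  by rewrite addrC lerD2l gauge_le_norm// => k; rewrite !mxE.
have cg k : `|c ord0 k - g ord0 k| <= e by rewrite distrC.
have [x gx] := ex_is_max (fun s => gauge (s - g)) S0.
have [y gy] := ex_is_min (fun s => gauge (s - g)) S0.
have [z cz] := ex_is_max (fun s => gauge (s - c)) S0.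
have [t ct] := ex_is_min (fun s => gauge (s - c)) S0.
rewrite /width/= (minballE gx) (maxballE gy) (minballE cz) (maxballE ct).
case: gx gy => [[s sS <-] _] [[s' s'S <-] _].
case: cz ct => [_ /(_ s sS) cz] [_ /(_ s' s'S) ct].
have := near _ _ gce s'; have := near _ _ cg s; lra.
Qed.

End Gauge.

(** * Recovering a center from the support values *)

Section LeftInverse.
Variables (R : realType) (d m : nat) (C : set 'rV[R]_d) (a : 'I_m -> 'rV[R]_d).
Hypothesis CE : C = halfspaces a (fun=> 1).
Hypothesis C_bounded : bounded_set C.

(* Boundedness makes the matrix with rows (a_i, 1) injective. *)
Lemma facet_left_inverse : exists L : 'M[R]_(d, m),
  (forall k (x : 'rV[R]_d), \sum_i L k i * dot (a i) x = x ord0 k) /\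
  (forall k, \sum_i L k i = 0).
Proof.
have [d0|d_gt0] := posnP d.
  have F (k : 'I_d) : False by case: k => k; rewrite d0.
  by exists 0; split=> k; case: (F k).
pose A := \matrix_(i < m, k < d) a i ord0 k.
pose M := row_mx A (const_mx 1 : 'cV[R]_m).
have gauge0 := @gauge_nonpos _ _ _ _ _ CE C_bounded.
(* Without inequalities [C] would be the whole space. A row is needed below to conclude that [y]
   vanishes. *)
have m_gt0 : (0 < m)%N.
  rewrite lt0n; apply/eqP => m0.
  have : (const_mx 1 : 'rV[R]_d) = 0
    by apply: gauge0 => i; have := ltn_ord i; rewrite [X in (_ < X)%N]m0.
  move/matrixP/(_ 0 (Ordinal d_gt0)); rewrite !mxE => /eqP.
  by rewrite oner_eq0.
have Mfree : row_free M^T.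
  apply: inj_row_free => v.
  rewrite -[v]hsubmxK tr_row_mx mul_row_col.
  set x := lsubmx v; set y := rsubmx v => v0.
  have xy i : dot (a i) x + y 0 0 = 0.
    move/matrixP/(_ 0 i): v0; rewrite !mxE big_ord1 !mxE mulr1 => <-.
    by congr (_ + _); apply: eq_bigr => k _; rewrite !mxE mulrC.
  (* All [dot (a i) x] equal the same number, minus the entry of [y], so [x] or [- x] is a recession
     direction. *)
  have x0 : x = 0.
    have [y0|y0] := leP 0 (y 0 0).
      by apply: gauge0 => i; have := xy i; lra.
    apply/eqP; rewrite -oppr_eq0; apply/eqP/gauge0 => i.
    by rewrite dotNr; have := xy i; lra.
  have y0 : y = 0.
    apply/rowP => j; rewrite ord1 [RHS]mxE; have := xy (Ordinal m_gt0).
    by rewrite x0 dotr0 add0r.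
  by rewrite x0 y0 row_mx0.
have /row_fullP [B BM] : row_full M by rewrite /row_full -mxrank_tr.
(* The first [d] rows of a left inverse of [M]: they reproduce [x] and annihilate constants. *)
pose L := (row_mx 1%:M 0 : 'M[R]_(d, d + 1)) *m B.
have : row_mx (L *m A) (L *m const_mx 1) = row_mx 1%:M (0 : 'cV[R]_d).
  by rewrite -mul_mx_row -mulmxA BM mulmx1.
move/eq_row_mx; clearbody L => -[LA L1]; exists L; split=> k => [x|].
  have <- : (L *m A *m x^T) k 0 = x ord0 k by rewrite LA mul1mx mxE.
  rewrite -mulmxA mxE; apply: eq_bigr => i _; congr (_ * _).
  by rewrite mxE; apply: eq_bigr => l _; rewrite !mxE.
move/matrixP/(_ k 0): L1; rewrite !mxE => L1k; rewrite -[RHS]L1k.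
by apply: eq_bigr => i _; rewrite mxE mulr1.
Qed.

End LeftInverse.

Section Approximation.
Variables (R : realType) (d m : nat) (C : set 'rV[R]_d) (a : 'I_m -> 'rV[R]_d).
Variable L : 'M[R]_(d, m).
Hypothesis CE : C = halfspaces a (fun=> 1).
Hypothesis C_bounded : bounded_set C.
Hypothesis C_facet : forall i, facet C (C `&` [set x | dot (a i) x = 1]).
Hypothesis LA : forall k (x : 'rV[R]_d), \sum_i L k i * dot (a i) x = x ord0 k.
Hypothesis L1 : forall k, \sum_i L k i = 0.
Implicit Types (p q v c g : 'rV[R]_d) (S : seq 'rV[R]_d).

(** If every [h i] were [dot (a i) c] plus one common radius, this would be exactly [c]: the rows of
    [L] sum to 0, so the unknown radius cancels. *)
Definition start_center (h : 'I_m -> R) : 'rV[R]_d :=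
  \row_k \sum_i L k i * h i.

(** A crude bound on the operator norm of [L] for the sup norm, with 1 added so that the grid radius
    is positive whenever the width is. *)
Definition start_error : R := 1 + \sum_k \sum_i `|L k i|.

(* Writing A for gauge_bound, E for start_error and W for the width of MWA(p) at
   the starting center p, one has W <= (1 + 2 A E) w_opt; a grid of spacing
   E W eps / fineness thus costs at most 2 A E W eps / fineness <= eps w_opt. *)
Definition fineness : R :=
  2 * gauge_bound a * start_error * (1 + 2 * gauge_bound a * start_error).

Lemma start_error_ge1 : 1 <= start_error.
Proof. by rewrite lerDl sumr_ge0// => i _; rewrite sumr_ge0. Qed.

Lemma fineness_ge1 : 1 <= fineness.
Proof.
rewrite /fineness; have := start_error_ge1; have := gauge_bound_ge1 a.
by move: (gauge_bound a) start_error => A E A1 E1; nra.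
Qed.

Lemma convex_hull_neq0 S c : convex_hull S c -> S != [::].
Proof.
move=> [w [_ + _]]; apply: contra_eq_neq => S0.
by subst S; rewrite big_ord0 eq_sym oner_neq0.
Qed.

(* For every i, h_i - a_i.c lies between the two radii of MWA(c): a point of S
   between the copies of facet i gives the lower bound. *)
Lemma start_center_near S c h : optimal_center C S c ->
  samples_facets C S (MWA C S c) ->
  (forall i, is_max (dot (a i)) S (h i)) ->
  forall k, `|start_center h ord0 k - c ord0 k|
            <= start_error * width (MWA C S c).
Proof.
move=> [/convex_hull_neq0 S0 _] smp hmax k.
have [x cx] := ex_is_max (fun s => gauge a (s - c)) S0.
have [y cy] := ex_is_min (fun s => gauge a (s - c)) S0.
have hx i : h i - dot (a i) c <= x.
  have [[s sS <-] _] := hmax i; rewrite -dotBr.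
  by apply: le_trans (gauge_ge _ _ _) _; apply: cx.2.
have hy i : y <= h i - dot (a i) c.
  have [s sS [z [lam [[_ /= zi] /andP[+ _] sE]]]] := smp _ (C_facet i).
  rewrite (maxballE CE C_bounded cy) => ylam; apply: le_trans ylam _.
  have := (hmax i).2 _ sS; rewrite sE dotDr dotZr zi mulr1.
  by rewrite lerBrDl.
rewrite /width/= (minballE CE C_bounded cx) (maxballE CE C_bounded cy).
(* Subtracting the inner radius [y] costs nothing since the rows of [L] sum to 0; it brings every
   factor into [[0, x - y]]. *)
have -> : start_center h ord0 k - c ord0 k
    = \sum_i L k i * (h i - dot (a i) c - y).
  transitivity (\sum_i (L k i * h i - L k i * dot (a i) c - L k i * y)).
    by rewrite !sumrB LA -mulr_suml L1 mul0r subr0 mxE.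
  by apply: eq_bigr => i _; ring.
have xy : 0 <= x - y.
  by rewrite subr_ge0; case: cx => -[s sS <-] _; apply: cy.2.
apply: le_trans (ler_norm_sum _ _ _) _.
apply: le_trans (_ : (\sum_i `|L k i|) * (x - y) <= _).
  rewrite mulr_suml; apply: ler_sum => i _; rewrite normrM ler_wpM2l//.
  by rewrite ger0_norm ?subr_ge0// lerB.
apply: ler_wpM2r => //; rewrite /start_error (bigD1 k)//= addrCA lerDl.
by rewrite addr_ge0// sumr_ge0// => j _; rewrite sumr_ge0.
Qed.

(** The target [u] is [c] in grid units, [(c - p) / rho]. It lies in the unit cube when [p] is worse
    than [c], because the distance bound [start_error * w] is then at most [rho]. *)
Lemma grid_approximation S c h (eps : R) : optimal_center C S c ->
  samples_facets C S (MWA C S c) -> 0 < eps ->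
  (forall i, is_max (dot (a i)) S (h i)) ->
  let p := start_center h in
  width (MWA C S p) <= (1 + eps) * width (MWA C S c) \/
  exists2 u : 'rV[R]_d, forall k, `|u ord0 k| <= 1 &
    forall t : 'rV[R]_d,
      (forall k, `|t ord0 k - u ord0 k| <= eps / fineness) ->
      width (MWA C S (p + (start_error * width (MWA C S p)) *: t))
        <= (1 + eps) * width (MWA C S c).
Proof.
move=> copt smp eps0 hmax p; set w := width (MWA C S c).
set W := width (MWA C S p).
have near := start_center_near copt smp hmax.
have E1 := start_error_ge1; have A1 := gauge_bound_ge1 a.
have S0 : S != [::] by case: copt => /convex_hull_neq0.
have w0 : 0 <= w.
  have [x cx] := ex_is_max (fun s => gauge a (s - c)) S0.
  have [y cy] := ex_is_min (fun s => gauge a (s - c)) S0.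
  rewrite /w/width/= (minballE CE C_bounded cx) (maxballE CE C_bounded cy).
  by rewrite subr_ge0; case: cx => -[s sS <-] _; apply: cy.2.
(* [c] is optimal only among centers in the hull of [S], which need not contain [p], so [W < w] is
   not excluded. *)
have [Ww|wW] := leP W w.
  by left; rewrite (le_trans Ww)// ler_peMl// lerDl ltW.
right.
have Ww : W <= (1 + 2 * gauge_bound a * start_error) * w.
  rewrite mulrDl mul1r -mulrA; apply: width_lipschitz => //.
  by rewrite mulr_ge0// (le_trans ler01).
set rho := start_error * W.
have W0 : 0 < W := le_lt_trans w0 wW.
have rho0 : 0 < rho by rewrite mulr_gt0// (lt_le_trans ltr01).
have rhoV (x : R) : rho * (rho^-1 * x) = x by rewrite mulrA divff ?mul1r ?gt_eqF.
exists (rho^-1 *: (c - p)) => [k|t tu].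
  rewrite mxE normrM gtr0_norm ?invr_gt0// ler_pdivrMl// mulr1 !mxE distrC.
  move: (near k); rewrite mxE => /le_trans; apply.
  by rewrite ler_pM2l ?(lt_le_trans ltr01)// ltW.
have F0 : 0 < fineness by rewrite (lt_le_trans ltr01) ?fineness_ge1.
have e0 : 0 <= rho * (eps / fineness).
  by rewrite mulr_ge0 ?(ltW rho0)// divr_ge0// ltW.
have := @width_lipschitz _ _ _ _ _ CE C_bounded S c (p + rho *: t) _ S0 e0.
move=> /(_ _)/le_trans; apply=> [k|].
  have -> : (p + rho *: t) ord0 k - c ord0 k
      = rho * (t ord0 k - (rho^-1 *: (c - p)) ord0 k).
    by rewrite mulrBr !mxE rhoV; ring.
  by rewrite normrM gtr0_norm// ler_pM2l.
rewrite -/w [leRHS]mulrDl mul1r lerD2l.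
have -> : 2 * gauge_bound a * (rho * (eps / fineness)) =
    eps * ((2 * gauge_bound a * start_error) * W / fineness).
  by rewrite /rho; ring.
rewrite ler_pM2l// ler_pdivrMr// /fineness [leRHS]mulrCA.
by rewrite ler_pM2l 1?[leRHS]mulrC// !mulr_gt0// (lt_le_trans ltr01).
Qed.

End Approximation.

(** * Reasoning about RAM programs *)

Reserved Notation "P ;; Q" (at level 60, right associativity).
Notation "P ;; Q" := (Seq P Q).

Section RamState.
Variable R : realType.
Implicit Types (c : instr R) (s : state R) (r : nat).

(** [step] reduces only on an explicit [State]; this form rewrites at any state. *)
Lemma stepE c s : step c s =
  match c with
  | IConst i k => State (upd (ireg s) i k) (rreg s) (Defs.mem s)
  | IAdd i j k =>
      State (upd (ireg s) i (ireg s j + ireg s k)%N) (rreg s) (Defs.mem s)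
  | ISub i j k =>
      State (upd (ireg s) i (ireg s j - ireg s k)%N) (rreg s) (Defs.mem s)
  | RConst i x => State (ireg s) (upd (rreg s) i x) (Defs.mem s)
  | RAdd i j k => State (ireg s) (upd (rreg s) i (rreg s j + rreg s k)) (Defs.mem s)
  | RSub i j k => State (ireg s) (upd (rreg s) i (rreg s j - rreg s k)) (Defs.mem s)
  | RMul i j k => State (ireg s) (upd (rreg s) i (rreg s j * rreg s k)) (Defs.mem s)
  | RDiv i j k => State (ireg s) (upd (rreg s) i (rreg s j / rreg s k)) (Defs.mem s)
  | RLoad i k => State (ireg s) (upd (rreg s) i (Defs.mem s (ireg s k))) (Defs.mem s)
  | RStore k i => State (ireg s) (rreg s) (upd (Defs.mem s) (ireg s k) (rreg s i))
  end.
Proof. by case: s; case: c. Qed.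

Lemma upd_same (T : Type) (f : nat -> T) i v : upd f i v i = v.
Proof. by rewrite /upd eqxx. Qed.

Lemma upd_other (T : Type) (f : nat -> T) i v j : j <> i -> upd f i v j = f j.
Proof. by rewrite /upd; case: eqP. Qed.

Fixpoint writes_real (P : program R) r : bool :=
  match P with
  | Instr (RConst i _ | RAdd i _ _ | RSub i _ _ | RMul i _ _ | RDiv i _ _
          | RLoad i _) => r == i
  | Seq P Q | If _ P Q => writes_real P r || writes_real Q r
  | While _ P => writes_real P r
  | _ => false
  end.

Fixpoint writes_int (P : program R) r : bool :=
  match P with
  | Instr (IConst i _ | IAdd i _ _ | ISub i _ _) => r == i
  | Seq P Q | If _ P Q => writes_int P r || writes_int Q r
  | While _ P => writes_int P r
  | _ => false
  end.

(* Loop-free, with neither divisions (which may be illegal) nor stores. *)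
Fixpoint simple (P : program R) : bool :=
  match P with
  | Instr (RDiv _ _ _ | RStore _ _) | While _ _ => false
  | Seq P Q | If _ P Q => simple P && simple Q
  | _ => true
  end.

(** An upper bound for [simple] programs: adding both branches of a test avoids a maximum. The value
    at [While] is a dummy. *)
Fixpoint cost (P : program R) : nat :=
  match P with
  | Skip => 0
  | Instr _ => 1
  | Seq P Q => cost P + cost Q
  | If _ P Q => (cost P + cost Q).+1
  | While _ _ => 0
  end.

Fixpoint den (P : program R) s : state R :=
  match P with
  | Instr c => step c s
  | Seq P Q => den Q (den P s)
  | If b P Q => if holds b s then den P s else den Q s
  | _ => s
  end.

Lemma den_seq P Q s : den (P ;; Q) s = den Q (den P s).
Proof. by []. Qed.

Lemma den_if b P Q s : den (If b P Q) s = if holds b s then den P s else den Q s.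
Proof. by []. Qed.

Lemma exec_den s P : simple P ->
  exists2 t, (t <= cost P)%N & exec P s t (den P s).
Proof.
elim: P s => [|c|P IHP Q IHQ|b P IHP Q IHQ|//] s /=.
- by exists 0%N => //; constructor.
- by move=> c_simple; exists 1%N => //; constructor; case: c c_simple.
- move=> /andP[sP sQ].
  have [t tP EP] := IHP s sP; have [u uQ EQ] := IHQ (den P s) sQ.
  by exists (t + u)%N; [exact: leq_add|exact: exec_seq EP EQ].
move=> /andP[sP sQ].
have [t tP EP] := IHP s sP; have [u uQ EQ] := IHQ s sQ.
case: ifPn => bs.
  by exists t.+1; [rewrite ltnS (leq_trans tP)// leq_addr|exact: exec_if_true].
by exists u.+1; [rewrite ltnS (leq_trans uQ)// leq_addl|exact: exec_if_false].
Qed.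

Lemma den_real P s r : ~~ writes_real P r -> rreg (den P s) r = rreg s r.
Proof.
elim: P s => [|c|P IHP Q IHQ|b P IHP Q IHQ|//] s //=.
- by rewrite stepE; case: c => //= *; rewrite upd_other//; apply/eqP.
- by rewrite negb_or => /andP[wP wQ]; rewrite IHQ// IHP.
- by rewrite negb_or => /andP[wP wQ]; case: ifP => _; [apply: IHP|apply: IHQ].
Qed.

Lemma den_int P s r : ~~ writes_int P r -> ireg (den P s) r = ireg s r.
Proof.
elim: P s => [|c|P IHP Q IHQ|b P IHP Q IHQ|//] s //=.
- by rewrite stepE; case: c => //= *; rewrite upd_other//; apply/eqP.
- by rewrite negb_or => /andP[wP wQ]; rewrite IHQ// IHP.
- by rewrite negb_or => /andP[wP wQ]; case: ifP => _; [apply: IHP|apply: IHQ].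
Qed.

Lemma den_mem P s : simple P -> Defs.mem (den P s) = Defs.mem s.
Proof.
elim: P s => [|c|P IHP Q IHQ|b P IHP Q IHQ|//] s //=.
- by rewrite stepE; case: c.
- by move=> /andP[/IHP EP /IHQ EQ]; rewrite EQ EP.
- by move=> /andP[/IHP EP /IHQ EQ]; case: ifP => _.
Qed.

(** A total-correctness triple with a time bound, stated for one initial state. *)
Definition run (P : program R) s (T : nat) (Post : state R -> Prop) :=
  exists t s', [/\ exec P s t s', (t <= T)%N & Post s'].

Lemma run_weaken P s T T' (Post Post' : state R -> Prop) :
  run P s T Post -> (T <= T')%N -> (forall s', Post s' -> Post' s') ->
  run P s T' Post'.
Proof.
move=> [t [s' [E tT Q]]] TT' PP'; exists t, s'.
by split; [|exact: leq_trans TT'|exact: PP'].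
Qed.

Lemma run_simple P s (Post : state R -> Prop) : simple P -> Post (den P s) ->
  run P s (cost P) Post.
Proof. by move=> /(exec_den s) [t tP E] Q; exists t, (den P s). Qed.

Lemma run_seq P Q s T1 T2 (Post : state R -> Prop) :
  run P s T1 (fun s' => run Q s' T2 Post) -> run (P ;; Q) s (T1 + T2) Post.
Proof.
move=> [t [s1 [E1 tT [u [s2 [E2 uT Q2]]]]]]; exists (t + u)%N, s2.
by split; [exact: exec_seq E1 E2|exact: leq_add|].
Qed.

(* The invariant is indexed by a bound on the number of remaining rounds. *)
Lemma run_while b P s N T (Inv : nat -> state R -> Prop) (Post : state R -> Prop) :
  (forall k s', Inv k.+1 s' -> holds b s' -> run P s' T (Inv k)) ->
  (forall s', Inv 0%N s' -> ~~ holds b s') ->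
  (forall k s', Inv k s' -> ~~ holds b s' -> Post s') ->
  Inv N s -> run (While b P) s (N * T.+1).+1 Post.
Proof.
move=> body stop exit; elim: N s => [|N IHN] s Is.
  exists 1%N, s; split=> //; last exact: exit Is (stop _ Is).
  by apply: exec_while_false; apply: stop.
have [bs|bs] := boolP (holds b s); last first.
  exists 1%N, s; split=> //; first exact: exec_while_false.
  exact: exit Is bs.
have [t [s1 [E1 tT /IHN [u [s2 [E2 uT Q2]]]]]] := body _ _ Is bs.
exists (t + u).+1, s2; split=> //; first exact: exec_while_true E1 E2.
rewrite ltnS mulSn addSn -addnS; exact: leq_add.
Qed.

Section Seqs.
Variables (I : eqType) (f : I -> program R).

(* The tail of the list is executed first, so that accumulating an operation
   into a register yields the corresponding big operator. *)
Fixpoint seqs (l : seq I) : program R :=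
  if l is i :: l' then seqs l' ;; f i else Skip R.

Lemma simple_seqs l : simple (seqs l) = all (fun i => simple (f i)) l.
Proof. by elim: l => //= i l ->; rewrite andbC. Qed.

Lemma writes_real_seqs l r :
  writes_real (seqs l) r = has (fun i => writes_real (f i) r) l.
Proof. by elim: l => //= i l ->; rewrite orbC. Qed.

Lemma writes_int_seqs l r :
  writes_int (seqs l) r = has (fun i => writes_int (f i) r) l.
Proof. by elim: l => //= i l ->; rewrite orbC. Qed.

Lemma run_seqs (Inv : seq I -> state R -> Prop) (T : I -> nat) l s :
  (forall i l' s', Inv l' s' -> run (f i) s' (T i) (Inv (i :: l'))) ->
  Inv [::] s -> run (seqs l) s (\sum_(i <- l) T i)%N (Inv l).
Proof.
move=> step I0; elim: l => [|i l IHl] /=.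
  by exists 0%N, s; split=> //; constructor.
rewrite big_cons addnC; apply: run_seq; apply: run_weaken IHl (leqnn _) _.
by move=> s'; apply: step.
Qed.

(** Uniqueness yields [i \notin l']: the code for [i] does not overwrite the registers already
    filled for [l']. *)
Lemma den_seqs (Inv : seq I -> state R -> Prop) l s :
  (forall i l' s', i \notin l' -> Inv l' s' -> Inv (i :: l') (den (f i) s')) ->
  uniq l -> Inv [::] s -> Inv l (den (seqs l) s).
Proof.
by move=> step + I0; elim: l => [//|i l IHl] /= /andP[il /IHl]; apply: step.
Qed.

End Seqs.

End RamState.

(** * The grid search *)

Section Algorithm.
Variables (R : realType) (d m : nat) (a : 'I_m -> 'rV[R]_d).
Implicit Types (s : state R) (v x : 'rV[R]_d) (S : seq 'rV[R]_d).

(* Registers below d + 2 hold the best annulus found so far, those from d + 2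
   to 2d + 6 are scratch, the others persist: rE is the grid step, rO the
   constant 1, rW the radius of the grid, vC the centre under evaluation, vT
   its grid coordinates and vP the centre of the grid. *)
Local Notation rT := (d + 2)%N.
Local Notation rA := (d + 3)%N.
Local Notation rD := (d + 4)%N.
Local Notation rX := (d + 5)%N.
Local Notation rN := (d + 6)%N.
Local Notation vQ := (d + 7)%N.
Local Notation rE := (2 * d + 7)%N.
Local Notation rO := (2 * d + 8)%N.
Local Notation rW := (2 * d + 9)%N.
Local Notation vC := (2 * d + 10)%N.
Local Notation vT := (3 * d + 10)%N.
Local Notation vP := (4 * d + 10)%N.

(** Disjointness of registers is linear arithmetic once the bounds of all ordinals in the context
    are available. *)
Local Ltac olia :=
  repeat match goal with k : _ |- _ =>
    lazymatch goal with
    | _ : is_true (leq (S (nat_of_ord k)) _) |- _ => fail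
    | _ => pose proof (ltn_ord k)
    end
  end; lia.

Local Ltac regs := rewrite /= ?stepE /=;
  repeat (rewrite upd_same || (rewrite upd_other; [|olia])).

Definition vec (b : nat) s : 'rV[R]_d := \row_k rreg s (b + k).

Lemma eq_vec b s s' : (forall k : 'I_d, rreg s' (b + k) = rreg s (b + k)) ->
  vec b s' = vec b s.
Proof. by move=> eq_ss'; apply/rowP => k; rewrite !mxE. Qed.

Definition mov (i j : nat) : program R :=
  Instr (RConst i 0) ;; Instr (RAdd R i i j).

Lemma den_mov i j s : i <> j -> rreg (den (mov i j) s) i = rreg s j.
Proof. by move=> ij; rewrite /mov; regs; rewrite add0r. Qed.

(** Integer registers: 0 holds the number of points, 1 the index of the current point, 2 its
    address, 3 the constant 1, and 4 is scratch. Among the real scratch registers, [vQ] holds the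
    point minus the center, [rA] a dot product, [rD] the measured value, [rX] and [rN] the running
    maximum and minimum. *)
Definition load : program R := seqs (fun k : 'I_d =>
  Instr (IConst R 4 k) ;; Instr (IAdd R 4 4 2) ;; Instr (RLoad R (vQ + k) 4) ;;
  Instr (RSub R (vQ + k) (vQ + k) (vC + k))) (enum 'I_d).

Lemma load_simple : simple load.
Proof. by rewrite simple_seqs; apply/allP. Qed.

Lemma load_real r : writes_real load r -> (d + 7 <= r < 2 * d + 7)%N.
Proof. rewrite writes_real_seqs => /hasP[k _ /=]; olia. Qed.

Lemma load_int r : writes_int load r -> r = 4%N.
Proof. rewrite writes_int_seqs => /hasP[k _ /=]; olia. Qed.

Lemma den_load s (k : 'I_d) : rreg (den load s) (vQ + k) =
  Defs.mem s (ireg s 2 + k) - rreg s (vC + k).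
Proof.
pose Inv (l : seq 'I_d) s' := [/\ Defs.mem s' = Defs.mem s, ireg s' 2 = ireg s 2,
  forall k : 'I_d, rreg s' (vC + k) = rreg s (vC + k) &
  {in l, forall k : 'I_d, rreg s' (vQ + k) =
     Defs.mem s (ireg s 2 + k) - rreg s (vC + k)}].
suff [_ _ _] : Inv (enum 'I_d) (den load s) by apply; rewrite mem_enum.
apply: den_seqs (enum_uniq _) _ => [i l s' il [M A C V]|]; last by split.
split.
- by rewrite den_mem.
- by rewrite den_int.
- move=> j; rewrite den_real ?C//=; olia.
move=> j; rewrite inE => /predU1P [->|jl].
  by regs; rewrite M A addnC C.
rewrite den_real ?V//=.
(* Distinct coordinates use distinct registers; [lia] needs this for the underlying numbers. *)
have ij : i <> j by move=> ij; rewrite ij jl in il.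
have ij' : nat_of_ord i <> j by move=> /val_inj.
olia.
Qed.

Definition dot_prog (v : 'rV[R]_d) : program R :=
  Instr (RConst rA 0) ;; seqs (fun k : 'I_d =>
    Instr (RConst rT (v ord0 k)) ;; Instr (RMul R rT rT (vQ + k)) ;;
    Instr (RAdd R rA rA rT)) (enum 'I_d).

Lemma dot_prog_real v r : writes_real (dot_prog v) r -> r = rT \/ r = rA.
Proof. by rewrite /= writes_real_seqs => /orP[|/hasP[k _ /=]]; olia. Qed.

Lemma dot_prog_int v r : ~~ writes_int (dot_prog v) r.
Proof. by rewrite /= writes_int_seqs; apply/negP => /hasP[]. Qed.

Lemma den_dot_prog v s : rreg (den (dot_prog v) s) rA = dot v (vec vQ s).
Proof.
pose Inv (l : seq 'I_d) s' := [/\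
  forall k : 'I_d, rreg s' (vQ + k) = rreg s (vQ + k) &
  rreg s' rA = \sum_(k <- l) v ord0 k * rreg s (vQ + k)].
suff [_ ->] : Inv (enum 'I_d) (den (dot_prog v) s).
  by rewrite big_enum /=; apply: eq_bigr => k _; rewrite mxE.
rewrite /dot_prog den_seq; apply: den_seqs (enum_uniq _) _ => [i l s' _ [C V]|].
  split=> [j|]; first by regs; rewrite C.
  by regs; rewrite C V big_cons addrC.
by split=> [j|]; regs; rewrite ?big_nil.
Qed.

(** The interface through which one scan serves both the support values and the distances. *)
Definition measures (M : program R) (f : 'rV[R]_d -> R) :=
  [/\ simple M, forall r, writes_real M r -> r = rT \/ r = rA \/ r = rD,
      forall r, ~~ writes_int M r &
      forall s, rreg (den M s) rD = f (vec vQ s)].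

Definition linear_prog (v : 'rV[R]_d) := dot_prog v ;; mov rD rA.

Lemma linear_progP v : measures (linear_prog v) (dot v).
Proof.
split.
- by rewrite /linear_prog /= simple_seqs andbT; apply/allP.
- by move=> r /orP[/dot_prog_real|/=]; olia.
- by move=> r; rewrite /linear_prog [writes_int _ _]orbF dot_prog_int.
- move=> s; rewrite -den_dot_prog /linear_prog den_seq den_mov//; olia.
Qed.

Definition gauge_prog : program R :=
  Instr (RConst rD 0) ;; seqs (fun i => dot_prog (a i) ;;
    If (RLt rD rA) (mov rD rA) (Skip R)) (enum 'I_m).

Lemma gauge_progP : measures gauge_prog (gauge a).
Proof.
split.
- by rewrite /gauge_prog [simple _]/= simple_seqs; apply/allP => i _;
    rewrite [simple _]/= simple_seqs andbT; apply/allP.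
- move=> r; rewrite [writes_real _ _]/= writes_real_seqs.
  by case/orP=> [|/hasP[i _ /orP[/dot_prog_real|/=]]]; olia.
- move=> r; rewrite /gauge_prog /= writes_int_seqs; apply/negP => /hasP[i _].
  by case/orP=> //; apply/negP; apply: dot_prog_int.
move=> s; pose Inv (l : seq 'I_m) s' := [/\
  forall k : 'I_d, rreg s' (vQ + k) = rreg s (vQ + k) &
  rreg s' rD = \big[Num.max/0]_(i <- l) dot (a i) (vec vQ s)].
suff [_ ->] : Inv (enum 'I_m) (den gauge_prog s) by rewrite big_enum.
rewrite /gauge_prog den_seq; apply: den_seqs (enum_uniq _) _ => [i l s' _ [C V]|];
  last by split=> [j|]; regs; rewrite ?big_nil.
have VE := eq_vec C.
split=> [j|].
  rewrite den_real ?C//; apply/negP => /orP[/dot_prog_real|/=]; olia.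
rewrite den_seq big_cons -V -VE -den_dot_prog.
have <- : rreg (den (dot_prog (a i)) s') rD = rreg s' rD.
  by rewrite den_real//; apply/negP => /dot_prog_real; olia.
rewrite den_if [holds _ _]/= maxC /Order.max; case: ifP => // _.
by rewrite den_mov//; olia.
Qed.

Definition scan_body (M : program R) : program R :=
  load ;; M ;; If (RLt rX rD) (mov rX rD) (Skip R) ;;
  If (RLt rD rN) (mov rN rD) (Skip R) ;;
  Instr (IConst R 4 d) ;; Instr (IAdd R 2 2 4) ;; Instr (IAdd R 1 1 3).

(** Point 0 initializes both extrema, in place of infinite sentinels; the loop then measures it
    again. *)
Definition scan_start (M : program R) : program R :=
  Instr (IConst R 3 1) ;; Instr (IConst R 2 0) ;; Instr (IConst R 1 0) ;;
  load ;; M ;; mov rX rD ;; mov rN rD.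

Definition scan (M : program R) : program R :=
  scan_start M ;; While (ILt 1 0) (scan_body M).

Definition scan_cost (M : program R) n : nat :=
  (cost (scan_start M) + (n * (cost (scan_body M)).+1).+1)%N.

Definition preserves s s' := [/\ ireg s' 0 = ireg s 0, Defs.mem s' = Defs.mem s &
  forall r, (r < d + 2)%N || (2 * d + 7 <= r)%N -> rreg s' r = rreg s r].

Lemma preserves_trans s2 s1 s3 :
  preserves s1 s2 -> preserves s2 s3 -> preserves s1 s3.
Proof.
move=> [A B C] [A' B' C']; split; rewrite ?A' ?B'//.
by move=> r rP; rewrite C' ?C.
Qed.

Lemma preserves_vec b s s' : preserves s s' -> (2 * d + 7 <= b)%N ->
  vec b s' = vec b s.
Proof. by move=> [_ _ C] bP; apply: eq_vec => k; apply: C; lia. Qed.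

Lemma preserves_den P s : simple P -> ~~ writes_int P 0 ->
  (forall r, writes_real P r -> (d + 2 <= r < 2 * d + 7)%N) ->
  preserves s (den P s).
Proof.
move=> sP iP rP; split; [exact: den_int|exact: den_mem|].
by move=> r r_out; apply: den_real; apply/negP => /rP; lia.
Qed.

(** * One pass over the points *)

Section Scan.
Variables (M : program R) (f : 'rV[R]_d -> R).
Hypothesis Mf : measures M f.

Lemma measure_frame s (s' := den M (den load s)) :
  [/\ preserves s s', forall i, i <> 4%N -> ireg s' i = ireg s i,
      rreg s' rX = rreg s rX & rreg s' rN = rreg s rN].
Proof.
have [sM rM iM _] := Mf.
have r_load r : (2 * d + 7 <= r)%N || (r < d + 7)%N ->
    rreg (den load s) r = rreg s r.
  by move=> r_out; apply: den_real; apply/negP => /load_real; lia.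
have i_load i : i <> 4%N -> ireg (den load s) i = ireg s i.
  by move=> i4; apply: den_int; apply/negP => /load_int.
rewrite /s'; split.
- apply: (@preserves_trans (den load s)); apply: preserves_den => //.
  + exact: load_simple.
  + by apply/negP => /load_int.
  + by move=> r /load_real; lia.
  + by move=> r /rM; lia.
- by move=> i i4; rewrite den_int// i_load.
- by rewrite den_real ?r_load; [|lia|apply/negP => /rM; lia].
- by rewrite den_real ?r_load; [|lia|apply/negP => /rM; lia].
Qed.

Variables (S : seq 'rV[R]_d) (c : 'rV[R]_d).

(** The extrema are attained in [S], not among the first [j] points: at [j = 0] they already come
    from point 0. *)
Definition scanned s s' (j : nat) := [/\ preserves s s',
  [/\ ireg s' 1 = j, ireg s' 2 = (j * d)%N & ireg s' 3 = 1%N],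
  (exists2 x, x \in S & f (x - c) = rreg s' rX) /\
    (forall i, (i < j)%N -> f (nth 0 S i - c) <= rreg s' rX) &
  (exists2 x, x \in S & f (x - c) = rreg s' rN) /\
    (forall i, (i < j)%N -> rreg s' rN <= f (nth 0 S i - c))].

Variable s : state R.
Hypothesis mem_s : forall j (k : 'I_d), (j < size S)%N ->
  Defs.mem s (j * d + k) = nth 0 S j ord0 k.
Hypothesis size_s : ireg s 0 = size S.
Hypothesis vC_s : vec vC s = c.
Hypothesis S_neq0 : S != [::].

Lemma measure_point s' j : preserves s s' -> ireg s' 2 = (j * d)%N ->
  (j < size S)%N -> rreg (den M (den load s')) rD = f (nth 0 S j - c).
Proof.
move=> ss' s'2 jS; have [_ _ _ ->] := Mf; congr f; apply/rowP => k.
have cE : vec vC s' = c by rewrite (preserves_vec ss') //; lia.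
rewrite mxE den_load s'2; case: ss' => _ -> _.
by rewrite mem_s// -cE !mxE.
Qed.

Lemma scan_startP : scanned s (den (scan_start M) s) 0.
Proof.
rewrite /scan_start 6!den_seq.
set s0 := den (Instr (IConst R 1 0)) _.
have ss0 : preserves s s0 by rewrite /s0; split=> [||r r_out]; regs.
have s02 : ireg s0 2 = (0 * d)%N by rewrite /s0; regs.
have S_gt0 : (0 < size S)%N by rewrite lt0n size_eq0.
have [ss1 i1 _ _] := measure_frame s0.
have := measure_point ss0 s02 S_gt0.
set s1 := den M (den load s0) in ss1 i1 *; clearbody s1 => D1.
split.
- apply: preserves_trans ss0 (preserves_trans ss1 _).
  by split=> [||r r_out]; regs.
- by split; regs; rewrite i1// /s0; regs.
- split=> [|//]; exists (nth 0 S 0); rewrite ?mem_nth// -D1.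
  by rewrite den_real ?den_mov//=; lia.
split=> [|//]; exists (nth 0 S 0); rewrite ?mem_nth// -D1.
by rewrite den_mov ?den_real//=; lia.
Qed.

Lemma scan_bodyP j s' : scanned s s' j -> (j < size S)%N ->
  scanned s (den (scan_body M) s') j.+1.
Proof.
move=> [ss' [s'1 s'2 s'3] [[x xS xX] leX] [[y yS yN] leN]] jS.
rewrite /scan_body 6!den_seq.
have [ss1 i1 X1 N1] := measure_frame s'.
have := measure_point ss' s'2 jS.
set s1 := den M (den load s') in ss1 i1 X1 N1 *; clearbody s1 => D1.
set s2 := den (If (RLt rX rD) _ _) s1.
have [X2 D2 N2] : [/\ rreg s2 rX = Num.max (rreg s' rX) (f (nth 0 S j - c)),
    rreg s2 rD = f (nth 0 S j - c) & rreg s2 rN = rreg s' rN].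
  rewrite /s2 den_if [holds _ _]/= X1 D1 -N1; split; rewrite -D1.
  - by rewrite /Order.max; case: ifP; rewrite ?den_mov//; lia.
  - by case: ifP => // _; rewrite den_real//=; lia.
  - by case: ifP => // _; rewrite den_real//=; lia.
have i2 i : ireg s2 i = ireg s1 i by rewrite /s2 den_int.
have ss2 : preserves s1 s2 by apply: preserves_den => // r /=; lia.
set s3 := den (If (RLt rD rN) _ _) s2.
have [X3 N3] : rreg s3 rX = Num.max (rreg s' rX) (f (nth 0 S j - c)) /\
    rreg s3 rN = Num.min (rreg s' rN) (f (nth 0 S j - c)).
  rewrite /s3 den_if [holds _ _]/= -X2 N2 D2; split.
    by case: ifP => // _; rewrite den_real//=; lia.
  rewrite minC /Order.min; case: ifP => // _; rewrite ?N2// den_mov ?D2//; lia.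
have i3 i : ireg s3 i = ireg s2 i by rewrite /s3 den_int.
have ss3 : preserves s2 s3 by apply: preserves_den => // r /=; lia.
split.
- apply: preserves_trans ss' (preserves_trans ss1 _).
  apply: preserves_trans ss2 (preserves_trans ss3 _).
  by split=> [||r r_out]; regs.
- by split; regs; rewrite !i3 !i2 !i1// ?s'1 ?s'2 ?s'3; lia.
- rewrite [rreg _ rX]/= !stepE/= X3; split.
    rewrite /Order.max; case: ifP => _; last by exists x.
    by exists (nth 0 S j); rewrite ?mem_nth.
  move=> i; rewrite ltnS leq_eqVlt => /predU1P [->|/leX];
    rewrite le_max ?lexx ?orbT//.
  by move=> ->.
- rewrite [rreg _ rN]/= !stepE/= N3; split.
    rewrite /Order.min; case: ifP => _; first by exists y.
    by exists (nth 0 S j); rewrite ?mem_nth.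
  move=> i; rewrite ltnS leq_eqVlt => /predU1P [->|/leN];
    rewrite ge_min ?lexx ?orbT//.
  by move=> ->.
Qed.

Lemma run_scan : run (scan M) s (scan_cost M (size S)) (fun s' =>
  [/\ preserves s s', is_max (fun x => f (x - c)) S (rreg s' rX) &
      is_min (fun x => f (x - c)) S (rreg s' rN)]).
Proof.
have [sM _ _ _] := Mf.
apply: run_seq; apply: (run_weaken (Post := fun s' => scanned s s' 0)) (leqnn _) _.
  by apply: run_simple scan_startP; rewrite /= load_simple sM.
move=> s0 s0P.
pose Inv k s' := exists2 j, (j + k)%N = size S & scanned s s' j.
apply: (run_while (Inv := Inv)); last by exists 0%N.
- move=> k s' [j jk s'P] s'_lt; apply: run_simple.
    by rewrite /= load_simple sM.
  by exists j.+1; [lia|apply: scan_bodyP => //; lia].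
- move=> s' [j jk [[E _ _] [E1 _ _] _ _]] /=; rewrite E E1 size_s; lia.
move=> k s' [j jk [ss' [E1 _ _] [xX leX] [yN leN]]] /=.
case: (ss') => E _ _; rewrite E E1 size_s -leqNgt => Sj.
split=> //; split=> // x xS; rewrite -(nth_index 0 xS).
  by apply: leX; apply: leq_trans Sj; rewrite index_mem.
by apply: leN; apply: leq_trans Sj; rewrite index_mem.
Qed.

End Scan.

(** * Evaluating candidate centers on the grid *)

Definition copy (b b' : nat) : program R :=
  seqs (fun k : 'I_d => mov (b + k) (b' + k)) (enum 'I_d).

Lemma copy_simple b b' : simple (copy b b').
Proof. by rewrite simple_seqs; apply/allP. Qed.

Lemma copy_int b b' i : ~~ writes_int (copy b b') i.
Proof. by rewrite writes_int_seqs; apply/negP => /hasP[]. Qed.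

Lemma copy_real b b' r : writes_real (copy b b') r -> (b <= r < b + d)%N.
Proof. by rewrite writes_real_seqs => /hasP[k _ /=]; olia. Qed.

Lemma den_copy b b' s : (b + d <= b')%N || (b' + d <= b)%N ->
  vec b (den (copy b b') s) = vec b' s.
Proof.
move=> bb'; pose Inv (l : seq 'I_d) s' :=
  (forall k : 'I_d, rreg s' (b' + k) = rreg s (b' + k)) /\
  {in l, forall k : 'I_d, rreg s' (b + k) = rreg s (b' + k)}.
suff [_ V] : Inv (enum 'I_d) (den (copy b b') s).
  by apply/rowP => k; rewrite !mxE V// mem_enum.
apply: den_seqs (enum_uniq _) _ => [i l s' il [C V]|]; last by split.
split=> j; first by rewrite den_real ?C//=; olia.
rewrite inE => /predU1P [->|jl]; first by rewrite den_mov ?C//; olia.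
rewrite den_real ?V//=.
have ij : i <> j by move=> ij; rewrite ij jl in il.
have ij' : nat_of_ord i <> j by move=> /val_inj.
lia.
Qed.

Definition save_best : program R := copy 0 vC ;; mov d rN ;; mov d.+1 rX.

Lemma save_best_int i : ~~ writes_int save_best i.
Proof. by rewrite /= !orbF copy_int. Qed.

Lemma save_best_real r : writes_real save_best r -> (r < d + 2)%N.
Proof. by move=> /orP[/copy_real|/=]; lia. Qed.

Lemma output_save_best s :
  output d (den save_best s) = Annulus (vec vC s) (rreg s rN) (rreg s rX).
Proof.
have V : vec 0 (den save_best s) = vec vC s.
  rewrite -(@den_copy 0 vC s); last by rewrite add0n; lia.
  by apply: eq_vec => k; rewrite /save_best 2!den_seq;
    rewrite [LHS]den_real 1?[LHS]den_real//=; olia.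
rewrite /output -[\row_k _]/(vec 0 (den save_best s)) V; congr Annulus.
  rewrite /save_best 2!den_seq den_real ?den_mov ?den_real//=; try lia.
  by apply/negP => /copy_real; lia.
rewrite /save_best 2!den_seq den_mov ?den_real//=; try lia.
by apply/negP => /copy_real; lia.
Qed.

Definition candidate : program R := seqs (fun k : 'I_d =>
  Instr (RMul R (vC + k) rW (vT + k)) ;;
  Instr (RAdd R (vC + k) (vC + k) (vP + k))) (enum 'I_d).

Lemma candidate_simple : simple candidate.
Proof. by rewrite simple_seqs; apply/allP. Qed.

Lemma candidate_int i : ~~ writes_int candidate i.
Proof. by rewrite writes_int_seqs; apply/negP => /hasP[]. Qed.

Lemma candidate_real r : writes_real candidate r -> (vC <= r < vC + d)%N.
Proof. by rewrite writes_real_seqs => /hasP[k _ /=]; olia. Qed.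

Lemma den_candidate s :
  vec vC (den candidate s) = vec vP s + rreg s rW *: vec vT s.
Proof.
pose Inv (l : seq 'I_d) s' := [/\ rreg s' rW = rreg s rW,
  forall k : 'I_d, rreg s' (vT + k) = rreg s (vT + k),
  forall k : 'I_d, rreg s' (vP + k) = rreg s (vP + k) &
  {in l, forall k : 'I_d, rreg s' (vC + k) =
     rreg s (vP + k) + rreg s rW * rreg s (vT + k)}].
suff [_ _ _ V] : Inv (enum 'I_d) (den candidate s).
  by apply/rowP => k; rewrite !mxE V// mem_enum.
apply: den_seqs (enum_uniq _) _ => [i l s' il [W T C V]|]; last by split.
split=> [|j|j|j].
- by rewrite den_real//=; olia.
- by rewrite den_real//=; olia.
- by rewrite den_real//=; olia.
rewrite inE => /predU1P [->|jl]; first by regs; rewrite W T C addrC.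
rewrite den_real ?V//=.
have ij : i <> j by move=> ij; rewrite ij jl in il.
have ij' : nat_of_ord i <> j by move=> /val_inj.
lia.
Qed.

Definition compare : program R :=
  Instr (RSub R rT rX rN) ;; Instr (RSub R rA d.+1 d) ;;
  If (RLt rT rA) save_best (Skip R).

Lemma compare_simple : simple compare.
Proof. by rewrite /= copy_simple. Qed.

Lemma compare_int i : ~~ writes_int compare i.
Proof. by rewrite /= !orbF copy_int. Qed.

Lemma compare_real r : writes_real compare r -> (r < d + 4)%N.
Proof. by move=> /or3P[/=|/=|/orP[/save_best_real|//]]; lia. Qed.

Lemma output_compare s (A := Annulus (vec vC s) (rreg s rN) (rreg s rX)) :
  output d (den compare s) =
  if width A < width (output d s) then A else output d s.
Proof.
rewrite /compare 2!den_seq den_if.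
set s1 := den (Instr (RSub R rT rX rN)) s.
set s2 := den (Instr (RSub R rA d.+1 d)) s1.
have s2r r : r <> rT -> r <> rA -> rreg s2 r = rreg s r.
  by move=> rT' rA'; rewrite /s2 /s1; regs.
have -> : holds (RLt rT rA) s2 = (width A < width (output d s)).
  by rewrite /s2 /s1 /width; regs.
case: ifP => _; first rewrite output_save_best /A.
  by congr Annulus; [apply: eq_vec => k|..]; rewrite s2r//; olia.
rewrite /= /output; congr Annulus; [apply/rowP => k|..]; rewrite ?mxE s2r//; olia.
Qed.

Definition probe : program R := candidate ;; scan gauge_prog ;; compare.

(** The loop at level [l] runs coordinate [l - 1] from -1 to 1; the higher coordinates are fixed by
    the enclosing loops. *)
Fixpoint grid (l : nat) : program R :=
  if l is k.+1 then
    Instr (RConst (vT + k) (-1)) ;;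
    While (RLe (vT + k) rO) (grid k ;; Instr (RAdd R (vT + k) (vT + k) rE))
  else probe.

Definition probe_cost n : nat :=
  (cost candidate + (scan_cost gauge_prog n + cost compare))%N.

Fixpoint grid_cost n (N l : nat) : nat :=
  if l is k.+1 then (1 + (N * (grid_cost n N k + 1).+1).+1)%N
  else probe_cost n.

Section Grid.
Variables (C : set 'rV[R]_d) (S : seq 'rV[R]_d) (mem0 : nat -> R).
Variables (p : 'rV[R]_d) (e rho : R).
Hypothesis CE : C = halfspaces a (fun=> 1).
Hypothesis C_bounded : bounded_set C.
Hypothesis S_neq0 : S != [::].
Hypothesis mem0E : forall j (k : 'I_d), (j < size S)%N ->
  mem0 (j * d + k)%N = nth 0 S j ord0 k.
Hypothesis e_gt0 : 0 < e.

Lemma run_scan_gauge s : ireg s 0 = size S -> Defs.mem s = mem0 ->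
  run (scan gauge_prog) s (scan_cost gauge_prog (size S)) (fun s' =>
    preserves s s' /\
    Annulus (vec vC s') (rreg s' rN) (rreg s' rX) = MWA C S (vec vC s)).
Proof.
move=> nE memE; apply: run_weaken (leqnn _) _.
  by apply: (run_scan gauge_progP (S := S) (c := vec vC s)) => //; rewrite memE.
move=> s' [ss' sX sN]; split=> //.
rewrite /MWA (minballE CE C_bounded sX) (maxballE CE C_bounded sN).
by rewrite (preserves_vec ss')//; lia.
Qed.

Definition ready s := [/\ ireg s 0 = size S, Defs.mem s = mem0, vec vP s = p,
  [/\ rreg s rE = e, rreg s rW = rho & rreg s rO = 1] &
  exists g, output d s = MWA C S g].

Lemma run_probe s : ready s -> run probe s (probe_cost (size S)) (fun s' =>
  [/\ ready s', vec vT s' = vec vT s,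
      width (output d s') <= width (output d s) &
      width (output d s') <= width (MWA C S (p + rho *: vec vT s))]).
Proof.
move=> [nE memE PE [EE WE OE] [g gE]].
pose s1 := den candidate s.
have s1r r : (r < vC)%N || (vC + d <= r)%N -> rreg s1 r = rreg s r.
  by move=> r_out; apply: den_real; apply/negP => /candidate_real; lia.
have s1o : output d s1 = output d s.
  by rewrite /output; congr Annulus; [apply/rowP => k; rewrite !mxE|..];
    rewrite s1r//; olia.
apply: run_seq; apply: (run_weaken (Post := eq s1)) (leqnn _) _.
  exact: run_simple candidate_simple _.
move=> _ <-; apply: run_seq; apply: run_weaken (leqnn _) _.
  by apply: run_scan_gauge; rewrite /s1 ?den_mem ?candidate_simple//;
    rewrite den_int ?candidate_int.
move=> s2 [[n2 mem2 r2] s2C]; apply: run_simple; first exact: compare_simple.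
rewrite den_candidate PE WE in s2C.
have s3r r : (rE <= r)%N -> (r < vC)%N || (vC + d <= r)%N ->
    rreg (den compare s2) r = rreg s r.
  move=> rE' r_out; rewrite den_real; last by apply/negP => /compare_real; lia.
  by rewrite r2 ?s1r//; lia.
have s2o : output d s2 = output d s.
  rewrite -s1o /output; congr Annulus; [apply/rowP => k; rewrite !mxE|..];
    rewrite r2//; olia.
split.
- split.
  + by rewrite den_int ?compare_int// n2 den_int ?candidate_int.
  + by rewrite den_mem ?compare_simple// mem2 den_mem ?candidate_simple.
  + by rewrite -PE; apply: eq_vec => k; apply: s3r; olia.
  + by split; rewrite s3r//; lia.
  + by rewrite output_compare s2C s2o; case: ifP => _;
      [exists (p + rho *: vec vT s)|exists g].
- by apply: eq_vec => k; apply: s3r; olia.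
- by rewrite output_compare s2C s2o; case: ifP => [/ltW|].
- by rewrite output_compare s2C s2o; case: ltP.
Qed.

Section Target.
Variables (u : 'rV[R]_d) (goal : R).

(** Kept as a premise of the last clause of [searched], so that termination and running time hold
    whether or not a target exists. *)
Definition hits := (forall k, `|u ord0 k| <= 1) /\
  forall t : 'rV[R]_d, (forall k, `|t ord0 k - u ord0 k| <= e) ->
    width (MWA C S (p + rho *: t)) <= goal.

Definition near_target s (l : nat) :=
  forall k : 'I_d, (l <= k)%N -> `|rreg s (vT + k) - u ord0 k| <= e.

Definition searched s s' (l : nat) := [/\ ready s',
  forall k : 'I_d, (l <= k)%N -> rreg s' (vT + k) = rreg s (vT + k),
  width (output d s') <= width (output d s) &
  hits -> near_target s l -> width (output d s') <= goal].

Lemma ready_eq s s' : ireg s' 0 = ireg s 0 -> Defs.mem s' = Defs.mem s ->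
  (forall r, (r < vT)%N || (vP <= r)%N -> rreg s' r = rreg s r) ->
  ready s -> ready s' /\ output d s' = output d s.
Proof.
move=> ii mm rr [nE memE PE [EE WE OE] gE].
have oo : output d s' = output d s.
  by rewrite /output; congr Annulus; [apply/rowP => k; rewrite !mxE|..];
    rewrite rr//; olia.
split=> //; split; rewrite ?ii ?mm ?oo//.
  by rewrite -PE; apply: eq_vec => k; rewrite rr//; olia.
by split; rewrite rr//; lia.
Qed.

(* While the coordinate being scanned has not come within e of u, it stays
   below u; as it finally exceeds 1 >= u, it must come that close. *)
Lemma run_grid N l s : 1 < -1 + N%:R * e -> (l <= d)%N -> ready s ->
  run (grid l) s (grid_cost (size S) N l) (fun s' => searched s s' l).
Proof.
move=> N_large; elim: l s => [|l IHl] s ld s_ready.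
  apply: run_weaken (run_probe s_ready) (leqnn _) _.
  move=> s' [rd TE le1 le2]; split=> // [k _|[_ H] near].
    by have /rowP/(_ k) := TE; rewrite !mxE.
  by apply: le_trans le2 _; apply: H => k; rewrite mxE near.
pose ul := u ord0 (Ordinal ld).
(* [k] further steps carry the coordinate past 1, so at [k = 0] the loop test fails. *)
pose Inv (k : nat) s' := [/\ ready s', 1 < rreg s' (vT + l) + k%:R * e,
  forall k : 'I_d, (l < k)%N -> rreg s' (vT + k) = rreg s (vT + k),
  width (output d s') <= width (output d s) &
  hits -> near_target s l.+1 ->
    width (output d s') <= goal \/ rreg s' (vT + l) <= ul].
apply: run_seq.
apply: (run_weaken (Post := Inv N)) (leqnn _) _.
  apply: run_simple => //.
  have [rd oE] : ready (den (Instr (RConst (vT + l) (-1))) s) /\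
      output d (den (Instr (RConst (vT + l) (-1))) s) = output d s.
    by apply: ready_eq => [||r r_out|//]; regs.
  split=> //.
  - by regs.
  - by move=> k lk; regs.
  - by rewrite oE.
  - move=> [u1 _] _; right; regs.
    by have := u1 (Ordinal ld); rewrite ler_norml -/ul => /andP[].
move=> s1 s1I; apply: (run_while (Inv := Inv)) s1I.
- move=> k s' [rd' large T le1 near] _; apply: run_seq.
  apply: run_weaken (IHl s' (ltnW ld) rd') (leqnn _) _.
  move=> s2 [rd2 T2 le2 near2]; apply: run_simple => //.
  have E2 : rreg s2 rE = e by case: rd2 => _ _ _ [].
  set s3 := den _ s2.
  have [rd3 oE] : ready s3 /\ output d s3 = output d s2.
    by apply: ready_eq => [||r r_out|//]; rewrite /s3; regs.
  have l3 : rreg s3 (vT + l) = rreg s' (vT + l) + e.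
    by rewrite /s3; regs; rewrite E2 (T2 (Ordinal ld)).
  split=> //.
  + by rewrite l3; move: large; rewrite -natr1; lra.
  + by move=> j lj; rewrite -T// -T2 ?(ltnW lj)// /s3; regs.
  + by rewrite oE (le_trans le2).
  + move=> H nr; rewrite oE l3; have [done|xu] := near H nr.
      by left; apply: le_trans done.
    have [close|far] := leP (ul - rreg s' (vT + l)) e; last by right; lra.
    left; apply: near2 => // j; rewrite leq_eqVlt => /predU1P [lj|lj].
      have -> : j = Ordinal ld by apply: val_inj.
      by rewrite distrC ger0_norm ?subr_ge0.
    by rewrite T//; apply: nr.
- move=> s' [rd' large _ _ _] /=.
  case: rd' => _ _ _ [_ _ ->] _; rewrite -ltNge.
  by move: large; rewrite mul0r addr0.
- move=> k s' [rd' _ T le1 near] /=.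
  case: (rd') => _ _ _ [_ _ ->] _; rewrite -ltNge => x1.
  split=> // H nr; have [//|xu] := near H nr.
  have := H.1 (Ordinal ld); rewrite -/ul ler_norml => /andP[_ u1].
  by move: (lt_le_trans x1 xu); rewrite ltNge u1.
Qed.

End Target.
End Grid.

Lemma scan_cost_le M n : (0 < n)%N ->
  (scan_cost M n <= (cost (scan_start M) + cost (scan_body M) + 2) * n)%N.
Proof. by rewrite /scan_cost; nia. Qed.

Lemma grid_cost_le l : exists A, forall n N, (0 < n)%N -> (0 < N)%N ->
  (grid_cost n N l <= A * N ^ l * n)%N.
Proof.
elim: l => [|l [A IHl]].
  exists (cost candidate + (cost (scan_start gauge_prog) +
    cost (scan_body gauge_prog) + 2) + cost compare)%N => n N n0 _ /=.
  rewrite /probe_cost expn0 muln1 2!mulnDl -addnA leq_add ?leq_pmulr//.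
  by rewrite leq_add ?leq_pmulr ?scan_cost_le.
(* A level adds [2 * N + 2 <= 4 * N] steps of its own. *)
exists (A + 4)%N => n N n0 N0 /=; have := IHl n N n0 N0.
have Nl : (0 < N ^ l)%N by rewrite expn_gt0 N0.
rewrite expnS => /(leq_mul (leqnn N)).
have : (N <= N * (N ^ l * n))%N by rewrite leq_pmulr// muln_gt0 Nl.
move: (N ^ l)%N (grid_cost n N l) => X g; lia.
Qed.

(** * The complete program and its running time *)

Section Main.
Variable L : 'M[R]_(d, m).

(** The grid step is computed at once because real register 0, which holds [eps], belongs to the
    output and is overwritten by [save_best]. *)
Definition init : program R :=
  Instr (RConst rT (fineness a L)^-1) ;; Instr (RMul R rE 0 rT).

(** Each support value is used while the scan still has it in [rX], so none has to be stored. *)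
Definition accum (i : 'I_m) : program R := seqs (fun k : 'I_d =>
  Instr (RConst rT (L k i)) ;; Instr (RMul R rT rT rX) ;;
  Instr (RAdd R (vP + k) (vP + k) rT)) (enum 'I_d).

(* vC and vP are still 0, as in the input state, before the first stage. *)
Definition stage (i : 'I_m) : program R := scan (linear_prog (a i)) ;; accum i.

(** The annulus at the starting center becomes the first best one, against which [compare] can
    measure the grid points. *)
Definition finish : program R :=
  save_best ;; Instr (RSub R rW rX rN) ;; Instr (RConst rT (start_error L)) ;;
  Instr (RMul R rW rT rW) ;; Instr (RConst rO 1).

Definition main : program R :=
  (init ;; seqs stage (enum 'I_m)) ;; copy vC vP ;; scan gauge_prog ;; finish ;;
  grid d.

Definition stage_cost n (i : 'I_m) : nat :=
  (scan_cost (linear_prog (a i)) n + cost (accum i))%N.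

Definition main_cost n N : nat :=
  (cost init + \sum_(i <- enum 'I_m) stage_cost n i + (cost (copy vC vP) +
    (scan_cost gauge_prog n + (cost finish + grid_cost n N d))))%N.

Lemma main_cost_le : exists A, forall n N, (0 < n)%N -> (0 < N)%N ->
  (main_cost n N <= A * N ^ d * n)%N.
Proof.
have [A gridA] := grid_cost_le d.
pose B i := (cost (scan_start (linear_prog (a i))) +
  cost (scan_body (linear_prog (a i))) + 2 + cost (accum i))%N.
exists (cost init + \sum_(i <- enum 'I_m) B i + cost (copy vC vP) +
  (cost (scan_start gauge_prog) + cost (scan_body gauge_prog) + 2) +
  cost finish + A)%N => n N n0 N0.
have : (\sum_(i <- enum 'I_m) stage_cost n i <=
        (\sum_(i <- enum 'I_m) B i) * n)%N.
  rewrite big_distrl /=; apply: leq_sum => i _; rewrite /stage_cost /B mulnDl.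
  by rewrite leq_add ?leq_pmulr ?scan_cost_le.
have := gridA n N n0 N0; have := scan_cost_le gauge_prog n0.
have : (0 < N ^ d)%N by rewrite expn_gt0 N0.
rewrite /main_cost; move: (\sum_(_ <- _) _)%N (\sum_(_ <- _) B _)%N => x b.
move: (cost _) (cost (copy _ _)) (scan_cost _ n) (_ + 2)%N (cost finish).
move: (grid_cost _ _ _) (N ^ d)%N => g X c1 c2 sc y c3 X0 le1 le2 le3.
have X1 z : (z * n <= z * X * n)%N by rewrite leq_mul// leq_pmulr.
have X2 z : (z <= z * X * n)%N by rewrite (leq_trans _ (X1 z))// leq_pmulr.
rewrite !mulnDl; have := X2 c1; have := X2 c2; have := X2 c3.
have := X1 b; have := X1 y; lia.
Qed.

Lemma accum_simple i : simple (accum i).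
Proof. by rewrite simple_seqs; apply/allP. Qed.

Lemma accum_int i j : ~~ writes_int (accum i) j.
Proof. by rewrite writes_int_seqs; apply/negP => /hasP[]. Qed.

Lemma accum_real i r :
  writes_real (accum i) r -> r = rT \/ (vP <= r)%N.
Proof. by rewrite writes_real_seqs => /hasP[k _ /=]; olia. Qed.

Lemma den_accum i s : vec vP (den (accum i) s) =
  vec vP s + rreg s rX *: (col i L)^T.
Proof.
pose Inv (l : seq 'I_d) s' := rreg s' rX = rreg s rX /\
  forall k : 'I_d, rreg s' (vP + k) =
    rreg s (vP + k) + (if k \in l then rreg s rX * L k i else 0).
suff [_ V] : Inv (enum 'I_d) (den (accum i) s).
  by apply/rowP => k; rewrite !mxE V mem_enum.
apply: den_seqs (enum_uniq _) _ => [j l s' jl [X V]|]; last first.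
  by split=> // k; rewrite addr0.
split=> [|k]; first by rewrite den_real//=; olia.
rewrite inE; have [->|kj] := eqVneq k j.
  by regs; rewrite V X (negPf jl) addr0 mulrC.
rewrite den_real ?V//=.
have kj' : nat_of_ord k <> j by move=> /val_inj /eqP; apply/negP.
olia.
Qed.

Variables (C : set 'rV[R]_d) (S : seq 'rV[R]_d) (eps : R) (h : 'I_m -> R).
Hypothesis CE : C = halfspaces a (fun=> 1).
Hypothesis C_bounded : bounded_set C.
Hypothesis S_neq0 : S != [::].
Hypothesis eps_gt0 : 0 < eps.
Hypothesis h_max : forall i, is_max (dot (a i)) S (h i).

Lemma mem_input j (k : 'I_d) : (j < size S)%N ->
  Defs.mem (input eps S) (j * d + k) = nth 0 S j ord0 k.
Proof.
rewrite /input /=; elim: S j => // x S' IH [|j] jS /=;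
  rewrite nth_cat size_map size_enum_ord.
  by rewrite mul0n add0n ltn_ord (nth_map k) ?size_enum_ord// nth_ord_enum.
by rewrite mulSn -addnA ltnNge leq_addr /= addKn IH.
Qed.

Let e := eps / fineness a L.
Let p := start_center L h.
Let mem0 := Defs.mem (input eps S).
Let rho := start_error L * width (MWA C S p).

Definition staged (l : seq 'I_m) s := [/\ ireg s 0 = size S, Defs.mem s = mem0,
  rreg s rE = e, vec vC s = 0 &
  vec vP s = \row_k \sum_(i <- l) L k i * h i].

Lemma run_stage i l s : staged l s ->
  run (stage i) s (stage_cost (size S) i) (staged (i :: l)).
Proof.
move=> [nE memE EE CE0 PE]; apply: run_seq.
apply: run_weaken (leqnn _) _.
  (* With center 0 the loaded difference is the point itself. *)
  by apply: (run_scan (linear_progP (a i)) (S := S) (c := 0)) => //; rewrite memE;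
    apply: mem_input.
move=> s' [[n' m' r'] X' _].
have {}X' : rreg s' rX = h i.
  apply: is_max_inj (h_max i).
  case: X' => -[x xS xX] leX; split; first by exists x; rewrite // -xX subr0.
  by move=> y /leX; rewrite subr0.
apply: run_simple; first exact: accum_simple.
have r3 r : (rE <= r)%N -> (r < vP)%N -> rreg (den (accum i) s') r = rreg s r.
  by move=> r1 r2; rewrite den_real ?r'; [|lia|apply/negP => /accum_real; lia].
split.
- by rewrite den_int ?accum_int// n'.
- by rewrite den_mem ?accum_simple// m'.
- by rewrite r3//; lia.
- by rewrite -CE0; apply: eq_vec => k; rewrite r3//; olia.
have PE' : vec vP s' = vec vP s by apply: eq_vec => k; apply: r'; lia.
rewrite den_accum PE' PE X'; apply/rowP => k; rewrite !mxE big_cons.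
by rewrite addrC mulrC.
Qed.

Lemma run_start : run (init ;; seqs stage (enum 'I_m)) (input eps S)
  (cost init + \sum_(i <- enum 'I_m) stage_cost (size S) i)%N
  (staged (enum 'I_m)).
Proof.
apply: run_seq.
apply: (run_weaken (Post := staged [::])) (leqnn _) _; last first.
  by move=> s; apply: run_seqs => i l s'; apply: run_stage.
apply: run_simple => //.
have r0 r : (rE < r)%N -> rreg (den init (input eps S)) r = 0.
  by move=> r1; rewrite /init den_real/=; [rewrite /upd; case: eqP => //; lia|lia].
split=> //.
- by rewrite /init; regs.
- by apply/rowP => k; rewrite !mxE r0//; lia.
- by apply/rowP => k; rewrite !mxE r0 ?big_nil//; lia.
Qed.

Lemma finish_simple : simple finish.
Proof. by rewrite /= copy_simple. Qed.

Lemma den_finish s : staged (enum 'I_m) s ->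
  forall s', preserves (den (copy vC vP) s) s' ->
    Annulus (vec vC s') (rreg s' rN) (rreg s' rX) = MWA C S p ->
  ready C S mem0 p e rho (den finish s') /\
  output d (den finish s') = MWA C S p.
Proof.
move=> [nE memE EE _ PE] s' [n' m' r'] s'C.
have PEp : vec vP s = p.
  by rewrite PE; apply/rowP => k; rewrite !mxE big_enum.
have oE : output d (den finish s') = MWA C S p.
  rewrite -s'C -output_save_best /finish den_seq; set s1 := den save_best s'.
  by rewrite /output; congr Annulus; [apply/rowP => k; rewrite !mxE|..]; regs.
have r1 r : (rE <= r)%N -> (r < vC)%N || (vC + d <= r)%N -> rreg s' r = rreg s r.
  move=> r2 r3; rewrite r'; last lia.
  by rewrite den_real//; apply/negP => /copy_real; lia.
have r2 r : (d + 2 <= r)%N -> rreg (den save_best s') r = rreg s' r.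
  by move=> r3; apply: den_real; apply/negP => /save_best_real; lia.
have f_real r : (rE <= r)%N -> r <> rO -> r <> rW ->
    rreg (den finish s') r = rreg s' r.
  move=> r3 r4 r5; apply: den_real; apply/negP => /orP[/save_best_real|/=]; lia.
have [fW fO] : rreg (den finish s') rW = rho /\ rreg (den finish s') rO = 1.
  have N2 := r2 rN; have X2 := r2 rX.
  rewrite /finish den_seq; move: (den save_best s') N2 X2 => s2 N2 X2.
  split; regs; rewrite ?N2 ?X2; try lia; last by [].
  by rewrite /rho -s'C.
split=> //; split.
- by rewrite den_int ?n' ?den_int ?copy_int//= orbF; apply: save_best_int.
- by rewrite den_mem ?finish_simple// m' den_mem ?copy_simple.
- by rewrite -PEp; apply: eq_vec => k; rewrite f_real ?r1//; olia.
- by rewrite f_real ?r1 ?EE//; lia.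
- by exists p.
Qed.

Lemma run_main N u goal : 1 < -1 + N%:R * e -> run main (input eps S)
  (main_cost (size S) N) (fun s =>
    [/\ exists g, output d s = MWA C S g,
        width (output d s) <= width (MWA C S p) &
        hits C S p e rho u goal -> width (output d s) <= goal]).
Proof.
move=> N_large; have e_gt0 : 0 < e.
  by rewrite divr_gt0// (lt_le_trans ltr01)// fineness_ge1.
apply: run_seq; apply: run_weaken run_start (leqnn _) _ => s1 s1P.
have [nE memE _ _ PE] := s1P.
have s2C : vec vC (den (copy vC vP) s1) = p.
  rewrite den_copy ?PE; last lia.
  by apply/rowP => k; rewrite !mxE big_enum.
apply: run_seq; apply: run_simple; first exact: copy_simple.
apply: run_seq; apply: run_weaken (leqnn _) _.
  apply: (run_scan_gauge (mem0 := mem0) CE C_bounded S_neq0) => //.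
  - by move=> j k; apply: mem_input.
  - by rewrite den_int ?copy_int.
  - by rewrite den_mem ?copy_simple.
move=> s2 [ss2 s2A]; rewrite s2C in s2A.
have [rd oE] := den_finish s1P ss2 s2A.
apply: run_seq; apply: run_simple; first exact: finish_simple.
apply: run_weaken (leqnn _) _.
  by apply: (run_grid CE C_bounded S_neq0 _ e_gt0 u goal N_large (leqnn d) rd);
    move=> j k; apply: mem_input.
move=> s4 [[_ _ _ _ gE] _ le1 le2]; split=> //; first by rewrite -oE.
by move=> H; apply: le2 => // k; rewrite leqNgt ltn_ord.
Qed.

End Main.
End Algorithm.

Theorem theorem5 (R : realType) (d : nat) (C : set 'rV[R]_d)
    (C_polyhedron : polyhedron C) (C_bounded : bounded_set C)
    (C_origin : interior C 0) :
  exists (P : program R) (K : R),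
    forall (eps : R) (S : seq 'rV[R]_d) (Sigma : set 'rV[R]_d) (delta : R)
           (c_opt : 'rV[R]_d),
      0 < eps < 1 ->
      uniq S ->
      optimal_center C S c_opt ->
      0 < delta ->
      uniform_sample Sigma delta S ->
      samples_facets C S (MWA C S c_opt) ->
      exists (t : nat) (s : state R) (g : 'rV[R]_d),
        [/\ exec P (input eps S) t s,
            t%:R <= K * eps ^- d * (size S)%:R,
            output d s = MWA C S g
          & width (MWA C S g) <= (1 + eps) * width (MWA C S c_opt)].
Proof.
have [m [a [CE C_facet]]] := polyhedron_facets C_polyhedron C_origin.
have [L [LA L1]] := facet_left_inverse CE C_bounded.
have [A costA] := main_cost_le a L.
pose F := fineness a L; have F1 : 1 <= F := fineness_ge1 a L.
have F0 : 0 < F by apply: lt_le_trans F1.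
(* As [eps < 1], a grid loop makes at most [2 * F / eps + 1 <= (2 * F + 1) / eps] rounds. *)
exists (main a L), (A%:R * (2 * F + 1) ^+ d).
move=> eps S _ delta c /andP[eps0 eps1] _ copt _ _ smp.
have S0 : S != [::] by case: copt => /convex_hull_neq0.
have n0 : (0 < size S)%N by rewrite lt0n size_eq0.
have [h h_max] := choice (fun i => ex_is_max (dot (a i)) S0).
pose e := eps / F; have e0 : 0 < e by rewrite divr_gt0.
have e2 : 0 <= 2 / e by rewrite divr_ge0// ltW.
(* The least number of steps [e] whose total exceeds 2, the length of [[-1, 1]]. *)
pose N := (Num.truncn (2 / e)).+1.
have [N_ge N_lt] := andP (truncn_itv e2).
have N_large : 1 < -1 + N%:R * e.
  by move: N_lt; rewrite ltr_pdivrMr// -/N; lra.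
have N_small : N%:R <= (2 * F + 1) / eps.
  rewrite /N -natr1 [leRHS]mulrDl lerD//.
    by rewrite (le_trans N_ge)// /e invf_div mulrA.
  by rewrite div1r invf_ge1// ltW.
have [t [s [E tT [[g gE] g_le]]]] : run (main a L) (input eps S)
    (main_cost a L (size S) N) (fun s => (exists g, output d s = MWA C S g) /\
      width (output d s) <= (1 + eps) * width (MWA C S c)).
  have [p_near|[u u1 u_near]] := grid_approximation CE C_bounded C_facet LA L1
      copt smp eps0 h_max.
    (* The starting center is already good enough here; target and goal are dummies. *)
    apply: run_weaken (run_main CE C_bounded S0 eps0 h_max 0 0 N_large) (leqnn _) _.
    by move=> s [gE le_p _]; split=> //; apply: le_trans p_near.
  apply: run_weaken (run_main CE C_bounded S0 eps0 h_max u
    ((1 + eps) * width (MWA C S c)) N_large) (leqnn _) _.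
  by move=> s [gE _ le_goal]; split=> //; apply: le_goal.
exists t, s, g; split; rewrite -?gE//.
have := leq_trans tT (costA _ N n0 isT); rewrite -(ler_nat R) => /le_trans; apply.
rewrite !natrM natrX ler_wpM2r// -[leRHS]mulrA ler_wpM2l//.
by rewrite -exprVn -exprMn lerXn2r ?nnegrE// (le_trans _ N_small).
Qed.
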